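(* Let $k\ge s\ge1$ be integers. Let $y(t)$ be the solution of the semi-discrete problem $\dot y=J_N\nabla H(y)$, $y(0)=y_0$ (defined in the context), obtained from the semilinear wave equation with periodic boundary conditions, and let $y_1=u(h)$ be the approximation to $y(h)$ provided by the HBVM$(k,s)$ method used with stepsize $h$. Then, as $h\to0$, $$y_1-y(h)=O(h^{2s+1}),$$ that is, the method has order $2s$. Moreover, assuming that $f$ is suitably regular, $$H(y_1)-H(y_0)=\begin{cases}0,&\text{if } f\in\Pi_\nu \text{ and } \nu\le 2k/s,\\ O(h^{2k+1}),&\text{otherwise.}\end{cases}$$
   Context: $\Pi_\nu$ denotes the set of polynomials of degree at most $\nu$. ''Suitably regular'' means sufficiently many times continuously differentiable; this is a standing assumption on $f:\mathbb{R}\to\mathbb{R}$. Semi-discrete problem: consider $u_{tt}=u_{xx}-f'(u)$ on $(0,1)\times(0,\infty)$ with initial data $u(x,0)=\psi_0(x)$, $u_t(x,0)=\psi_1(x)$ and periodic boundary conditions. With $\Delta x=1/N$ and $x_i=i\Delta x$, $i=0,\dots,N-1$, the vectors $q(t)=(u_0(t),\dots,u_{N-1}(t))^\top$ and $p(t)=(v_0(t),\dots,v_{N-1}(t))^\top$ (with $u_i(t)\approx u(x_i,t)$, $v_i(t)\approx u_t(x_i,t)$) satisfy $$\dot q=p,\qquad \dot p=-\frac1{\Delta x^2}T_Nq-f'(q),$$ with $f'$ applied componentwise, where $T_N\in\mathbb{R}^{N\times N}$ is the circulant matrix with $2$ on the diagonal, $-1$ on the first sub- and superdiagonals, and $-1$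 in the corner entries $(1,N)$ and $(N,1)$. With $y=(q,p)\in\mathbb{R}^{2N}$ this is $\dot y=J_N\nabla H(y)$, where $J_N=\frac1{\Delta x}\begin{pmatrix}0&I_N\\-I_N&0\end{pmatrix}$ and $$H(y)=H(q,p)=\Delta x\left[\frac{p^\top p}{2}+\frac{q^\top T_Nq}{2\Delta x^2}+\sum_{i=0}^{N-1}f(u_i)\right].$$ The initial value $y_0=y(0)$ has entries $\psi_0(x_i)$ (for $q$) and $\psi_1(x_i)$ (for $p$). HBVM$(k,s)$ method with stepsize $h$: let $\{P_j\}_{j\ge0}$ be the orthonormal Legendre polynomials on $[0,1]$ ($\deg P_j=j$, $\int_0^1P_iP_j\,dx=\delta_{ij}$), and let $c_1,\dots,c_k$ and $b_1,\dots,b_k$ be the nodes and weights of the Gauss-Legendre quadrature formula on $[0,1]$ (of order $2k$). One looks for a polynomial $u$ of degree at most $s$ with values in $\mathbb{R}^{2N}$ such that $u(0)=y_0$ and $$\dot u(ch)=\sum_{j=0}^{s-1}\hat\gamma_j(u)P_j(c),\quad c\in[0,1],\qquad \hat\gamma_j(u)=\sum_{i=1}^kb_iP_j(c_i)\,J_N\nabla H(u(c_ih)),\quad j=0,\dots,s-1,$$ and sets $y_1=u(h)$.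
   Formalization: The polynomials u solving the HBVM equations are also assumed to stay bounded on [0,h] as h→0+; without this the order claim fails, since the nonlinear equations can have spurious roots blowing up as h→0 (e.g. k=s=1, f(q)=−q³/3, constant data). *)

(* Defs.v *)
From HB Require Import structures.
From mathcomp Require Import all_boot all_order all_algebra.
From mathcomp Require Import all_classical all_reals all_analysis.
Set Implicit Arguments.
Unset Strict Implicit.
Unset Printing Implicit Defensive.
Import Order.TTheory GRing.Theory Num.Theory.
Import numFieldNormedType.Exports.
Local Open Scope classical_set_scope.
Local Open Scope ring_scope.

Section Regularity.
Variable R : realType.

Definition is_Cn (m : nat) (f : R -> R) : Prop :=
  (forall i x, (i < m)%N -> derivable (derive1n i f) x 1) /\
  continuous (derive1n m f).

(* The set Pi_nu of polynomial functions of degree at most nu. *)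
Definition poly_fun (nu : nat) (f : R -> R) : Prop :=
  exists2 p : {poly R}, (size p <= nu.+1)%N & forall x, f x = p.[x].

End Regularity.

Section SemiDiscreteWave.
Variables (R : realType) (N : nat) (f : R -> R).

Definition dx : R := N%:R^-1.

(* The test modulo N covers the corner entries.  This is T_N for N >= 3; when
   N = 2 the corners coincide with the sub- and superdiagonal entries (value
   -1), and when N = 1 the diagonal takes precedence. *)
Definition T_ : 'M[R]_N :=
  \matrix_(i, j)
    if i == j then 2
    else if ((i.+1 %% N == j)%N || (j.+1 %% N == i)%N) then -1 else 0.

(* y = (q, p) is stored as the block column col_mx q p. *)
Definition hamiltonian (y : 'cV[R]_(N + N)) : R :=
  let q := usubmx y in let p := dsubmx y in
  dx * ((p^T *m p) 0 0 / 2 + (q^T *m T_ *m q) 0 0 / (2 * dx ^+ 2)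
        + \sum_(i < N) f (q i 0)).

Definition gradient (d : nat) (H : 'cV[R]_d -> R) (y : 'cV[R]_d) : 'cV[R]_d :=
  \col_i 'D_(delta_mx i 0) H y.

Definition J_ : 'M[R]_(N + N) :=
  dx^-1 *: block_mx 0 1%:M (- 1%:M) 0.

Definition wave_field (y : 'cV[R]_(N + N)) : 'cV[R]_(N + N) :=
  J_ *m gradient hamiltonian y.

Definition wave_init (psi0 psi1 : R -> R) : 'cV[R]_(N + N) :=
  col_mx (\col_(i < N) psi0 (i%:R * dx)) (\col_(i < N) psi1 (i%:R * dx)).

End SemiDiscreteWave.

(* Solution of y' = F(y), y(0) = y0 on [0, T[. *)
Definition ode_solution (R : realType) (d : nat) (F : 'cV[R]_d -> 'cV[R]_d)
    (y0 : 'cV[R]_d) (T : R) (y : R -> 'cV[R]_d) : Prop :=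
  [/\ y 0 = y0, {within `[0, T[, continuous y}
    & forall t, 0 < t < T -> is_derive t 1 y (F (y t))].

Section HBVM.
Variable R : realType.

Definition integral01 (p : {poly R}) : R :=
  \int[lebesgue_measure]_(x in `[0, 1]) p.[x].

(* These conditions determine each P j up to its sign, and the HBVM equations
   below do not depend on the signs. *)
Definition orthonormal_legendre (P : nat -> {poly R}) : Prop :=
  (forall j, size (P j) = j.+1) /\
  (forall i j, integral01 (P i * P j) = (i == j)%:R).

(* The nodes are the k distinct zeros of P k; the weights are those of the
   interpolatory quadrature formula, i.e. the integrals of the Lagrange
   cardinal polynomials. *)
Definition gauss_legendre (P : nat -> {poly R}) (k : nat) (c b : 'I_k -> R) :
    Prop :=
  [/\ injective c, forall i, root (P k) (c i)
    & forall i, b i =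
        integral01 (\prod_(j < k | j != i) ((c i - c j)^-1 *: ('X - (c j)%:P)))].

(* A polynomial with values in R^d is a column of scalar polynomials. *)
Definition cvhorner (d : nat) (u : 'cV[{poly R}]_d) (t : R) : 'cV[R]_d :=
  map_mx (fun p : {poly R} => p.[t]) u.

Definition cvderiv (d : nat) (u : 'cV[{poly R}]_d) : 'cV[{poly R}]_d :=
  map_mx (@deriv R) u.

Definition hbvm_coef (P : nat -> {poly R}) (k d : nat) (c b : 'I_k -> R)
    (F : 'cV[R]_d -> 'cV[R]_d) (h : R) (u : 'cV[{poly R}]_d) (j : nat) :
    'cV[R]_d :=
  \sum_(i < k) (b i * (P j).[c i]) *: F (cvhorner u (c i * h)).

(* u is a polynomial defining one HBVM(k,s) step of size h for y' = F(y) from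
   y0; the new approximation is then u(h). *)
Definition hbvm (P : nat -> {poly R}) (k s d : nat) (c b : 'I_k -> R)
    (F : 'cV[R]_d -> 'cV[R]_d) (y0 : 'cV[R]_d) (h : R) (u : 'cV[{poly R}]_d) :
    Prop :=
  [/\ forall i, (size (u i ord0) <= s.+1)%N,
      cvhorner u 0 = y0
    & forall x, 0 <= x <= 1 ->
        cvhorner (cvderiv u) (x * h)
        = \sum_(j < s) (P j).[x] *: hbvm_coef P c b F h u j].

(* The HBVM equations are nonlinear and can have, besides the root near y0,
   spurious roots that blow up as h -> 0 (e.g. the midpoint rule for z' = z^2
   has one with z_1 ~ 4 / h).  The family u of step polynomials, indexed by the
   stepsize h, is therefore required not to blow up. *)
Definition hbvm_family (P : nat -> {poly R}) (k s d : nat) (c b : 'I_k -> R)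
    (F : 'cV[R]_d -> 'cV[R]_d) (y0 : 'cV[R]_d) (h0 : R)
    (u : R -> 'cV[{poly R}]_d) : Prop :=
  (forall h, 0 < h < h0 -> hbvm P s c b F y0 h (u h)) /\
  (exists M : R, \forall h \near 0^'+,
     forall x, 0 <= x <= 1 -> `|cvhorner (u h) (x * h)| <= M).

End HBVM.

(* Main.v *)
(* With x = t / h, the step polynomial U(x) = u(x h) has coefficients
   U_i = O(h^i): if this holds up to h^n, Taylor expansion of f' shows that
   F(U) is, up to O(h^n), a polynomial with coefficients O(h^i), and exactness
   of the quadrature makes its j-th Legendre coefficient O(h^j), which raises n
   by one.

   Order.  u' - F(u) is, up to O(h^(2k)), a polynomial r in x which is O(h^s)
   and whose integral against x^i is O(h^(2k-i)) for i < s.  The error e = u - y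
   is then O(h^(s+1)) and satisfies e' = F'(u) e + r + O(e^2).  Testing against a
   polynomial approximation of the solution of the adjoint equation
   w' = - w F'(u) turns the contribution of r into the integral of w r, which is
   O(h^(2s)); hence e(h) = O(h^(2s+1)).

   Energy.  The quadrature sum of (d/dx) H(U(x)) vanishes because J is skew, so
   H(y1) - H(y0) is the quadrature error of that function, which is a
   polynomial of degree < 2k in the first case, and h times (a polynomial with
   coefficients O(h^i) plus O(h^(2k))) in general. *)
Require Import Defs.
From HB Require Import structures.
From mathcomp Require Import all_boot all_order all_algebra.
From mathcomp Require Import all_classical all_reals all_analysis.
From mathcomp Require Import ring lra zify.
Import Order.TTheory GRing.Theory Num.Theory.
Import numFieldNormedType.Exports.
Local Open Scope classical_set_scope.
Local Open Scope ring_scope.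
Set Implicit Arguments.
Unset Strict Implicit.
Unset Printing Implicit Defensive.

(** * Gauss-Legendre quadrature *)

(** The functions of [h] and [x] that occur (field along the step, energy rate, Jacobian) are never
    expanded by differentiating them repeatedly in [x]. Each is compared, uniformly in [x], with a
    polynomial whose [i]-th coefficient is O(h^i). Sums, products and composition with a smooth
    scalar function preserve this, and as the nonlinearity acts componentwise, Taylor's formula in
    one variable is enough. A linear functional that kills the first [m] monomials is O(h^m) on such
    a polynomial, so orders are read off by counting monomials. The only initial information on the
    step polynomials is that they are bounded. Integrating over one step gains a factor [h], so
    estimates grow from boundedness in a fixed number of rounds, which replaces Gronwall's lemma.
    The adjoint weights are prescribed at x = 0 rather than at x = 1, so that successive Picard
    iterates differ by polynomials with a high-order zero at 0. At x = 1 they equal a unit vector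
    only up to O(h); a final induction on the order removes the resulting mixing of components. *)

Section Quadrature.
Variable R : realType.
Implicit Types p q : {poly R}.

Lemma scalar_expand (L : {poly R} -> R) n p :
  scalar L -> (size p <= n)%N -> L p = \sum_(i < n) p`_i * L 'X^i.
Proof.
move=> hL sp.
pose LL : {scalar {poly R}} := HB.pack L (GRing.isLinear.Build _ _ _ _ L hL).
have -> : p = \sum_(i < n) p`_i *: 'X^i.
  by rewrite -poly_def; apply/polyP => i; rewrite coef_poly;
    case: ltnP => // /(leq_trans sp)/(nth_default 0).
rewrite -[L]/(LL : _ -> _) linear_sum /=.
apply: eq_bigr => i _; rewrite [LHS](scalarZ LL) coef_sum; congr (_ * _).
rewrite (bigD1 i) //= coefZ coefXn eqxx mulr1 big1 ?addr0 // => j ji.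
by rewrite coefZ coefXn eq_sym val_eqE (negPf ji) mulr0.
Qed.

(** At index 0 the quotient is a division by 0, hence 0 by convention: this antiderivative vanishes
    at 0. *)
Definition prim p : {poly R} := \poly_(i < (size p).+1) (p`_i.-1 / i%:R).

Lemma coef_prim p i : (prim p)`_i = p`_i.-1 / i%:R.
Proof.
rewrite coef_poly; case: ltnP => //; case: i => // i.
by rewrite ltnS => /(nth_default 0) /= ->; rewrite mul0r.
Qed.

Lemma deriv_prim p : (prim p)^`() = p.
Proof.
apply/polyP => i; rewrite coef_deriv coef_prim /= -mulrnAr -mulr_natr mulVf
  ?mulr1 ?pnatr_eq0 //.
Qed.

Lemma prim0E p : (prim p).[0] = 0.
Proof. by rewrite horner_coef0 coef_prim invr0 mulr0. Qed.

Lemma is_derive_horner p (x : R) : is_derive x 1 (horner p) p^`().[x].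
Proof.
apply: DeriveDef; first exact: derivable_horner.
by rewrite -derive1E -derivE.
Qed.

(** The only contact with Lebesgue integration; from here on integrals are values of
    antiderivatives. *)
Lemma integral01E p : integral01 p = (prim p).[1].
Proof.
rewrite /integral01 /Rintegral (@continuous_FTC2 _ (horner p) (horner (prim p))) //=.
- by rewrite prim0E oppr0 addr0.
- by apply: continuous_subspaceT => x; exact: continuous_horner.
- split=> [x _||]; first exact: derivable_horner.
  + by apply: cvg_at_right_filter; exact: continuous_horner.
  + by apply: cvg_at_left_filter; exact: continuous_horner.
- by move=> x _; rewrite -derivE deriv_prim.
Qed.

Lemma integral01_is_scalar : scalar (@integral01 R).
Proof.
move=> a p q; rewrite !integral01E -hornerZ -hornerD; congr horner.
by apply/polyP => i; rewrite coefD coefZ !coef_prim coefD coefZ mulrDl mulrA.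
Qed.

HB.instance Definition _ :=
  GRing.isLinear.Build R {poly R} R *%R (@integral01 R) integral01_is_scalar.

Lemma integral01Z a p : integral01 (a *: p) = a * integral01 p.
Proof. exact: scalarZ. Qed.

Lemma integral01D p q : integral01 (p + q) = integral01 p + integral01 q.
Proof. exact: linearD. Qed.

Lemma integral01B p q : integral01 (p - q) = integral01 p - integral01 q.
Proof. exact: linearB. Qed.

Lemma integral01_sum (I : Type) (r : seq I) (Q : pred I) (F : I -> {poly R}) :
  integral01 (\sum_(i <- r | Q i) F i) = \sum_(i <- r | Q i) integral01 (F i).
Proof. exact: linear_sum. Qed.

Lemma integral01_deriv p : integral01 p^`() = p.[1] - p.[0].
Proof.
pose d := prim p^`() - p.
have E : d^`() = 0 by rewrite derivB deriv_prim subrr.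
have sE : (size d <= 1)%N.
  apply/leq_sizeP => -[//|i] _; have := congr1 (fun q : {poly R} => q`_i) E.
  by rewrite coef_deriv coef0 => /eqP; rewrite mulrn_eq0 /= => /eqP.
have d01 : d.[0] = d.[1] by rewrite (size1_polyC sE) !hornerC.
by move: d01; rewrite !hornerD !hornerN prim0E integral01E; lra.
Qed.

Lemma integral01_mean p : exists2 x, 0 <= x <= 1 & integral01 p = p.[x].
Proof.
have [||x] := @MVT_segment R (horner (prim p)) (horner p) 0 1 ler01.
- by move=> x _; have := is_derive_horner (prim p) x; rewrite deriv_prim.
- by apply: continuous_subspaceT => x; exact: continuous_horner.
rewrite in_itv /= => hx E; exists x => //.
by rewrite integral01E; move: E; rewrite prim0E !subr0 mulr1.
Qed.

Lemma integral01_le p M : (forall x, 0 <= x <= 1 -> `|p.[x]| <= M) ->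
  `|integral01 p| <= M.
Proof. by have [x hx ->] := integral01_mean p; apply. Qed.

(** * Legendre expansions *)

Section Legendre.
Variable P : nat -> {poly R}.
Hypothesis HP : orthonormal_legendre P.

Lemma size_legendre j : size (P j) = j.+1. Proof. exact: HP.1. Qed.

(** [P n] has exact degree [n], so subtracting a multiple of it removes the top coefficient. *)
Lemma legendre_span n p : (size p <= n)%N ->
  exists a : nat -> R, p = \sum_(j < n) a j *: P j.
Proof.
elim: n p => [|n IH] p sp.
  by exists (fun=> 0); rewrite big_ord0; apply/eqP; rewrite -size_poly_eq0 -leqn0.
have Pn0 : (P n)`_n != 0.
  have := lead_coef_eq0 (P n).
  by rewrite lead_coefE size_legendre -size_poly_eq0 size_legendre => ->.
pose a0 := p`_n / (P n)`_n.
have [a Ea] : exists a : nat -> R, p - a0 *: P n = \sum_(j < n) a j *: P j.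
  apply: IH; apply/leq_sizeP => j; rewrite leq_eqVlt => /predU1P[<-|nj].
    by rewrite coefB coefZ divfK ?subrr.
  rewrite coefB coefZ !nth_default ?size_legendre ?mulr0 ?subrr //.
  exact: leq_trans sp nj.
exists (fun j => if j == n then a0 else a j).
rewrite big_ord_recr /= eqxx; under eq_bigr do rewrite ltn_eqF //.
by rewrite -Ea subrK.
Qed.

Lemma legendre_expand n p : (size p <= n)%N ->
  p = \sum_(j < n) integral01 (p * P j) *: P j.
Proof.
move=> /legendre_span[a ea]; rewrite {1}ea; apply: eq_bigr => j _; congr (_ *: _).
rewrite ea mulr_suml integral01_sum (bigD1 j) //= -scalerAl integral01Z HP.2 eqxx
  mulr1.
rewrite big1 ?addr0 // => i ij; rewrite -scalerAl integral01Z HP.2.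
by rewrite val_eqE (negPf ij) mulr0.
Qed.

Lemma legendre_ortho n p : (size p <= n)%N -> integral01 (P n * p) = 0.
Proof.
move=> /legendre_span[a ->]; rewrite mulr_sumr integral01_sum big1 // => j _.
by rewrite -scalerAr integral01Z HP.2 gtn_eqF ?mulr0.
Qed.

(** Legendre coefficients are integrals over [0, 1], so the supremum there controls them and,
    through them, the ordinary coefficients. This makes the coefficients of bounded step polynomials
    bounded, and with [M = 0] it identifies polynomials that agree on [0, 1]. *)
Lemma coef_bound n : exists2 C, 0 <= C & forall p M, (size p <= n)%N ->
  (forall x, 0 <= x <= 1 -> `|p.[x]| <= M) -> forall i, `|p`_i| <= C * M.
Proof.
have hB j : exists2 B, 0 <= B & forall x, 0 <= x <= 1 -> `|(P j).[x]| <= B.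
  exists (\sum_(i < size (P j)) `|(P j)`_i|) => [|x /andP[x0 x1]].
    by apply: sumr_ge0.
  rewrite horner_coef (le_trans (ler_norm_sum _ _ _)) // ler_sum // => i _.
  by rewrite normrM normrX ler_piMr // exprn_ile1 // ger0_norm.
have [B B0 hB'] : exists2 B : nat -> R, (forall j, 0 <= B j)
    & forall j x, 0 <= x <= 1 -> `|(P j).[x]| <= B j.
  have /choice[B hB''] : forall j, exists B, 0 <= B /\ forall x, 0 <= x <= 1 ->
    `|(P j).[x]| <= B.
    by move=> j; have [b b0 ?] := hB j; exists b.
  by exists B => j; [exact: (hB'' j).1|exact: (hB'' j).2].
exists (\sum_(j < n) B j * \sum_(i < n) `|(P j)`_i|).
  by apply: sumr_ge0 => j _; rewrite mulr_ge0 ?sumr_ge0.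
move=> p M sp hM i.
have M0 : 0 <= M by apply: le_trans (hM 0 _); rewrite ?lexx ?ler01.
have [ni|ni] := leqP n i.
  rewrite nth_default ?normr0; last exact: leq_trans sp ni.
  by rewrite mulr_ge0 ?sumr_ge0 // => j _; rewrite mulr_ge0 ?sumr_ge0.
rewrite (legendre_expand sp) coef_sum (le_trans (ler_norm_sum _ _ _)) //.
rewrite mulr_suml ler_sum // => j _; rewrite coefZ normrM mulrAC ler_pM //.
  apply: integral01_le => x hx; rewrite hornerM normrM mulrC ler_pM //.
    exact: hB'.
  exact: hM.
by rewrite (bigD1 (Ordinal ni)) //= lerDl sumr_ge0.
Qed.

(** * Exactness of the Gauss formula *)

Section Gauss.
Variables (k : nat) (c b : 'I_k -> R).
Hypothesis Hcb : gauss_legendre P c b.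

Definition quad p : R := \sum_(i < k) b i * p.[c i].

Lemma quad_is_scalar : scalar quad.
Proof.
move=> a p q; rewrite /quad mulr_sumr -big_split; apply: eq_bigr => i _ /=.
by rewrite hornerD hornerZ; ring.
Qed.

(** Divide by [P k]. The quotient has size at most [k], so its product with [P k] integrates to 0,
    and the quadrature does not see that product because the nodes are roots of [P k]. The remainder
    is its own Lagrange interpolant, which the weights integrate exactly by definition. *)
Lemma quad_exact p : (size p <= k + k)%N -> quad p = integral01 p.
Proof.
case: Hcb => injc rc Eb sp.
have Pk0 : P k != 0 by rewrite -size_poly_eq0 size_legendre.
pose ell i : {poly R} := \prod_(j < k | j != i) ((c i - c j)^-1 *: ('X - (c j)%:P)).
have ellE i j : (ell i).[c j] = (i == j)%:R.
  rewrite horner_prod; have [->|ij] := eqVneq i j.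
    rewrite big1 // => l lj; rewrite hornerZ hornerXsubC mulVf // subr_eq0.
    by rewrite (inj_eq injc) eq_sym.
  by rewrite (bigD1 j) 1?eq_sym //= hornerZ hornerXsubC subrr mulr0 mul0r.
have size_ell i : (size (ell i) <= k)%N.
  apply: (leq_trans (size_prod_leq _ _)).
  have -> : #|[pred j | j != i]| = k.-1 by rewrite cardC1 card_ord.
  rewrite leq_subLR (@leq_trans (1 + \sum_(j < k | j != i) 2)) //.
    rewrite add1n ltnS; apply: leq_sum => j _.
    by rewrite (leq_trans (size_scale_leq _ _)) // size_XsubC.
  rewrite sum_nat_const cardC1 card_ord muln2 -addnn.
  by case: k i => [[]//|n] i /=; rewrite addnS add1n.
pose r := p %% P k; pose q := p %/ P k.
have sr : (size r <= k)%N by rewrite -ltnS -(size_legendre k) ltn_modp.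
have sq : (size q <= k)%N.
  by rewrite size_divp // size_legendre /= leq_subLR.
have Ep : p = q * P k + r by exact: divp_eq.
have -> : integral01 p = integral01 r.
  by rewrite Ep integral01D mulrC legendre_ortho // add0r.
have Er : r = \sum_(i < k) r.[c i] *: ell i.
  apply/eqP; rewrite -subr_eq0; apply/eqP.
  apply: (@roots_geq_poly_eq0 _ _ [seq c i | i <- enum 'I_k]).
  - apply/allP => _ /mapP[i _ ->]; rewrite rootE hornerD hornerN horner_sum.
    rewrite (bigD1 i) //= hornerZ ellE eqxx mulr1 big1 ?addr0 ?subrr //.
    by move=> j ji; rewrite hornerZ ellE (negPf ji) mulr0.
  - by rewrite map_inj_uniq // enum_uniq.
  - rewrite size_map size_enum_ord (leq_trans (size_polyD _ _)) // geq_max sr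
    size_polyN.
    apply: (leq_trans (size_sum _ _ _)); apply/bigmax_leqP => i _.
    exact: leq_trans (size_scale_leq _ _) (size_ell i).
rewrite Er integral01_sum; apply: eq_bigr => i _.
rewrite integral01Z Eb mulrC; congr (_ * _).
by rewrite Ep hornerD hornerM (rootP (rc i)) mulr0 add0r.
Qed.

End Gauss.
End Legendre.
End Quadrature.

(** * Taylor expansion *)

Section Taylor.
Variable R : realType.
Implicit Types f g : R -> R.

Lemma is_Cn_continuous n f : is_Cn n f -> continuous f.
Proof.
case: n => [[_ //]|n [df _]] x.
by apply/differentiable_continuous/derivable1_diffP; exact: (df 0%N).
Qed.

Lemma derive1nSr n f : derive1n n.+1 f = derive1n n (derive1 f).
Proof. exact: iterSr. Qed.

Lemma is_Cn_derive n f : is_Cn n.+1 f -> is_Cn n (derive1 f).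
Proof.
move=> [df cf]; split=> [i x lin|].
  by rewrite -derive1nSr; exact: df.
by rewrite -derive1nSr.
Qed.

Lemma is_CnW m n f : (n <= m)%N -> is_Cn m f -> is_Cn n f.
Proof.
rewrite leq_eqVlt => /predU1P[->//|nm] [df cf]; split=> [i x lin|x].
  by apply: df; exact: ltn_trans nm.
by apply/differentiable_continuous/derivable1_diffP; exact: df.
Qed.

Lemma is_Cn_is_derive n f (x : R) : is_Cn n.+1 f -> is_derive x 1 f (derive1 f x).
Proof. by case=> df _; apply: DeriveDef; [exact: (df 0%N)|rewrite derive1E]. Qed.

Lemma continuous_bound f M : continuous f ->
  exists2 C, 0 <= C & forall x, `|x| <= M -> `|f x| <= C.
Proof.
move=> cf; have [M0|M0] := leP 0 M; last first.
  by exists 0 => // x /(le_trans (normr_ge0 x)) /le_lt_trans /(_ M0); rewrite ltxx.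
have MM : - M <= M by lra.
have cnf : {within `[- M, M], continuous (fun x => `|f x|)}.
  apply: continuous_subspaceT => x.
  by apply: continuous_comp; [exact: cf|exact: norm_continuous].
have [x0 _ hx0] := EVT_max MM cnf.
by exists `|f x0| => // x xM; apply: hx0; rewrite in_itv /= -ler_norml.
Qed.

Lemma mean_value f (df : R -> R) (a z : R) : (forall x : R, is_derive x 1 f (df x)) ->
  exists2 c, Num.min a z <= c <= Num.max a z & f z - f a = df c * (z - a).
Proof.
move=> hf; have cf : continuous f.
  by move=> x; apply/differentiable_continuous/derivable1_diffP; have [] := hf x.
have [az|/ltW za] := leP a z.
- have [c] := @MVT_segment R f df a z az (fun x _ => hf x) (continuous_subspaceT cf).
  by rewrite in_itv /= => ? ?; exists c.
- have [c] := @MVT_segment R f df z a za (fun x _ => hf x) (continuous_subspaceT cf).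
  by rewrite in_itv /= => ? E; exists c => //; rewrite -opprB E; ring.
Qed.

Definition taylor n g a : {poly R} :=
  \sum_(i < n) (derive1n i g a / i`!%:R) *: ('X - a%:P) ^+ i.

Lemma taylorE n g a z :
  (taylor n g a).[z] = \sum_(i < n) derive1n i g a / i`!%:R * (z - a) ^+ i.
Proof.
by rewrite horner_sum; apply: eq_bigr => i _; rewrite hornerZ horner_exp hornerXsubC.
Qed.

Lemma deriv_taylor n g a : (taylor n.+1 g a)^`() = taylor n (derive1 g) a.
Proof.
rewrite /taylor big_ord_recl derivD derivZ expr0 derivC scaler0 add0r raddf_sum /=.
apply: eq_bigr => i _; rewrite derivZ deriv_exp derivXsubC mul1r -derive1nSr.
rewrite /bump leq0n add1n /= -scalerMnr scalerMnl; congr (_ *: _).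
rewrite factS natrM invfM mulrCA -mulr_natr mulrAC mulVf ?mul1r //.
Qed.

Lemma taylor_bound n g M : is_Cn n g -> exists2 C, 0 <= C &
  forall a z, `|a| <= M -> `|z| <= M ->
    `|g z - (taylor n g a).[z]| <= C * `|z - a| ^+ n.
Proof.
elim: n g => [|n IH] g hg.
  have [C C0 hC] := continuous_bound M (is_Cn_continuous hg).
  exists C => // a z _ zM; rewrite taylorE big_ord0 subr0 expr0 mulr1.
  exact: hC.
have [C C0 hC] := IH _ (is_Cn_derive hg); exists C => // a z aM zM.
pose rho x := g x - (taylor n.+1 g a).[x].
have drho (x : R) : is_derive x 1 rho (derive1 g x - (taylor n (derive1 g) a).[x]).
  apply: is_deriveB; first exact: is_Cn_is_derive hg.
  by rewrite -deriv_taylor; exact: is_derive_horner.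
have [c hc E] := mean_value a z drho.
have rho0 : rho a = 0.
  rewrite /rho taylorE big_ord_recl expr0 fact0 divr1 mulr1 big1 ?addr0 ?subrr //
    => i _.
  by rewrite expr0n /= mulr0.
have [cM ca] : `|c| <= M /\ `|c - a| <= `|z - a|.
  move: hc aM zM; rewrite !ler_norml => /andP[] + + /andP[? ?] /andP[? ?].
  by have [az|/ltW za] := leP a z => ? ?; split;
    [|rewrite ger0_norm; lra| |rewrite ler0_norm; lra]; apply/andP; split; lra.
move: E; rewrite rho0 subr0 /rho => ->; rewrite normrM exprSr mulrA ler_wpM2r //.
apply: (le_trans (hC _ _ aM cM)); rewrite ler_wpM2l //.
by rewrite lerXn2r ?nnegrE.
Qed.

End Taylor.

(** * Families of functions indexed by the stepsize *)

Section Families.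
Variables (R : realType) (S : set R).
Implicit Types p q : R -> {poly R}.
Hypothesis S01 : forall h, S h -> 0 < h <= 1.

Let S_ge0 h : S h -> 0 <= h. Proof. by move=> /S01 /andP[/ltW]. Qed.
Let S_le1 h : S h -> h <= 1. Proof. by move=> /S01 /andP[]. Qed.

Let S_exp_ge0 h n : S h -> 0 <= h ^+ n. Proof. by move=> /S_ge0 /exprn_ge0. Qed.

(** Uniform in the second argument and valid on all of [S], so that combining finitely many
    estimates never shrinks the range of stepsizes. With [T] equal to [unit] it speaks of quantities
    depending on [h] alone. *)
Definition bigO (T : Type) (X : set T) n (phi : R -> T -> R) :=
  exists2 C, 0 <= C & forall h x, S h -> X x -> `|phi h x| <= C * h ^+ n.

(** * Calculus of uniform estimates in powers of the stepsize *)

Section BigO.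
Variables (T : Type) (X : set T).
Implicit Types phi psi : R -> T -> R.

Lemma bigO_eq n phi psi : (forall h x, S h -> X x -> phi h x = psi h x) ->
  bigO X n phi -> bigO X n psi.
Proof. by move=> e [C C0 hC]; exists C => // h x Sh Xx; rewrite -e //; exact: hC. Qed.

Lemma bigO_le m n phi : (m <= n)%N -> bigO X n phi -> bigO X m phi.
Proof.
move=> mn [C C0 hC]; exists C => // h x Sh Xx; apply: (le_trans (hC h x Sh Xx)).
by rewrite ler_wpM2l // ler_wiXn2l ?S_ge0 ?S_le1.
Qed.

Lemma bigO_cst (a : R) : bigO X 0 (fun _ _ => a).
Proof. by exists `|a| => // h x _ _; rewrite expr0 mulr1. Qed.

Lemma bigO0 n : bigO X n (fun _ _ => 0).
Proof. by exists 0 => // h x _ _; rewrite normr0 mul0r. Qed.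

Lemma bigO_step : bigO X 1 (fun h _ => h).
Proof. by exists 1 => // h x Sh _; rewrite mul1r expr1 ger0_norm ?S_ge0. Qed.

Lemma bigON n phi : bigO X n phi -> bigO X n (fun h x => - phi h x).
Proof. by move=> [C C0 hC]; exists C => // h x Sh Xx; rewrite normrN; exact: hC. Qed.

Lemma bigOD n phi psi : bigO X n phi -> bigO X n psi ->
  bigO X n (fun h x => phi h x + psi h x).
Proof.
move=> [C C0 hC] [D D0 hD]; exists (C + D); first exact: addr_ge0.
by move=> h x Sh Xx; rewrite mulrDl (le_trans (ler_normD _ _)) // lerD ?hC ?hD.
Qed.

Lemma bigOB n phi psi : bigO X n phi -> bigO X n psi ->
  bigO X n (fun h x => phi h x - psi h x).
Proof. by move=> hp hq; apply: bigOD => //; exact: bigON. Qed.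

Lemma bigOM m n phi psi : bigO X m phi -> bigO X n psi ->
  bigO X (m + n) (fun h x => phi h x * psi h x).
Proof.
move=> [C C0 hC] [D D0 hD]; exists (C * D); first exact: mulr_ge0.
by move=> h x Sh Xx; rewrite normrM exprD mulrACA ler_pM ?hC ?hD.
Qed.

Lemma bigOMl n phi psi : bigO X 0 phi -> bigO X n psi ->
  bigO X n (fun h x => phi h x * psi h x).
Proof. exact: bigOM. Qed.

Lemma bigOMr n phi psi : bigO X n phi -> bigO X 0 psi ->
  bigO X n (fun h x => phi h x * psi h x).
Proof. by move=> h1 h2; rewrite -[n]addn0; apply: bigOM. Qed.

Lemma bigO_sum (I : Type) (r : seq I) (Q : pred I) n (F : I -> R -> T -> R) :
  (forall i, Q i -> bigO X n (F i)) ->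
  bigO X n (fun h x => \sum_(i <- r | Q i) F i h x).
Proof.
move=> hF; elim: r => [|i r IH].
  by apply: bigO_eq (bigO0 n) => h x _ _; rewrite big_nil.
case Qi: (Q i); last by apply: bigO_eq IH => h x _ _; rewrite big_cons Qi.
by apply: bigO_eq (bigOD (hF i Qi) IH) => h x _ _; rewrite big_cons Qi.
Qed.

Lemma bigO_exp n phi : bigO X 1 phi -> bigO X n (fun h x => phi h x ^+ n).
Proof.
move=> hp; elim: n => [|n IH]; first exact: bigO_cst.
by apply: bigO_eq (bigOM hp IH) => h x _ _; rewrite exprS.
Qed.

Lemma bigO_abs n phi psi : (forall h x, S h -> X x -> `|phi h x| <= `|psi h x|) ->
  bigO X n psi -> bigO X n phi.
Proof.
by move=> le [C C0 hC]; exists C => // h x Sh Xx;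
  apply: le_trans (le _ _ Sh Xx) (hC _ _ Sh Xx).
Qed.

End BigO.

Lemma bigO_comp (T U : Type) (X : set T) (Y : set U) (f : U -> T) n
    (phi : R -> T -> R) :
  (forall y, Y y -> X (f y)) -> bigO X n phi -> bigO Y n (fun h y => phi h (f y)).
Proof. by move=> fY [C C0 hC]; exists C => // h y Sh /fY; exact: hC. Qed.

(* In the unscaled variable t = x h: bounded coefficients, and a zero of order
   at least v at t = 0. *)
Definition graded v (p : R -> {poly R}) :=
  [/\ exists D, forall h, S h -> (size (p h) <= D)%N,
      forall h i, S h -> (i < v)%N -> (p h)`_i = 0
    & exists2 C, 0 <= C & forall h i, S h -> `|(p h)`_i| <= C * h ^+ i].

Lemma graded_eq v p q : (forall h, S h -> p h = q h) -> graded v p -> graded v q.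
Proof.
move=> e [[D hD] hv [C C0 hC]]; split.
- by exists D => h Sh; rewrite -e // hD.
- by move=> h i Sh; rewrite -e //; exact: hv.
- by exists C => // h i Sh; rewrite -e // hC.
Qed.

Lemma graded_le u v p : (u <= v)%N -> graded v p -> graded u p.
Proof. by move=> uv [? hv ?]; split=> // h i Sh iu; apply: hv => //;
  exact: leq_trans uv. Qed.

Lemma gradedD v p q : graded v p -> graded v q -> graded v (fun h => p h + q h).
Proof.
move=> [[D hD] hv [C C0 hC]] [[D' hD'] hv' [C' C'0 hC']]; split.
- exists (maxn D D') => h Sh; rewrite (leq_trans (size_polyD _ _)) //.
  by rewrite geq_max !leq_max hD // hD' // orbT.
- by move=> h i Sh iv; rewrite coefD hv // hv' // addr0.
- exists (C + C'); first exact: addr_ge0.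
  move=> h i Sh; rewrite coefD mulrDl (le_trans (ler_normD _ _)) //.
  by rewrite lerD ?hC ?hC'.
Qed.

Lemma gradedM u v p q : graded u p -> graded v q ->
  graded (u + v) (fun h => p h * q h).
Proof.
move=> [[D hD] hv [C C0 hC]] [[D' hD'] hv' [C' C'0 hC']]; split.
- exists (D + D')%N => h Sh; rewrite (leq_trans (size_polyMleq _ _)) //.
  by rewrite (leq_trans (leq_pred _)) // leq_add ?hD ?hD'.
- move=> h i Sh iv; rewrite coefM big1 // => j _.
  have [ju|uj] := ltnP j u; first by rewrite hv ?mul0r.
  by rewrite hv' ?mulr0 // ltn_subLR ?(leq_trans iv) ?leq_add2r // -ltnS.
(* The coefficient of index [i] is a sum of [i + 1] products, at most [D + D'] of them below the
   size bound. *)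
- exists ((D + D')%:R * (C * C')); first by rewrite !mulr_ge0.
  move=> h i Sh; have [iD|Di] := ltnP i (D + D').
    rewrite coefM (le_trans (ler_norm_sum _ _ _)) //.
    apply: (@le_trans _ _ (\sum_(j < i.+1) C * C' * h ^+ i)).
      apply: ler_sum => j _; rewrite normrM.
      have -> : h ^+ i = h ^+ j * h ^+ (i - j) by rewrite -exprD subnKC // -ltnS.
      by rewrite mulrACA ler_pM ?hC ?hC'.
    rewrite sumr_const card_ord -[leLHS]mulr_natl -[leRHS]mulrA.
    apply: ler_wpM2r; last by rewrite ler_nat.
    by apply: mulr_ge0; [exact: mulr_ge0|exact: S_exp_ge0].
  rewrite nth_default; first by rewrite normr0 !mulr_ge0 ?S_exp_ge0.
  rewrite (leq_trans (size_polyMleq _ _)) // (leq_trans (leq_pred _)) //.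
  by rewrite (leq_trans _ Di) // leq_add ?hD ?hD'.
Qed.

Lemma graded0M p q : graded 0 p -> graded 0 q -> graded 0 (fun h => p h * q h).
Proof. exact: gradedM. Qed.

Lemma graded_const (a : R -> R) : bigO [set: unit] 0 (fun h _ => a h) ->
  graded 0 (fun h => (a h)%:P).
Proof.
move=> [C C0 hC]; split=> //; first by exists 1%N => h _; rewrite size_polyC leq_b1.
exists C => // h [|i] Sh; rewrite coefC //=; first exact: (hC h tt).
by rewrite normr0 mulr_ge0 ?S_exp_ge0.
Qed.

Lemma graded0 v : graded v (fun _ => 0).
Proof.
split; first by exists 0%N => h _; rewrite size_poly0.
  by move=> *; rewrite coef0.
by exists 0 => // h i _; rewrite coef0 normr0 mul0r.
Qed.

Lemma gradedN v p : graded v p -> graded v (fun h => - p h).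
Proof.
move=> [[D hD] hv [C C0 hC]]; split; first by exists D => h Sh; rewrite size_polyN hD.
  by move=> h i Sh iv; rewrite coefN hv ?oppr0.
by exists C => // h i Sh; rewrite coefN normrN hC.
Qed.

Lemma gradedB v p q : graded v p -> graded v q -> graded v (fun h => p h - q h).
Proof. by move=> hp hq; apply: gradedD => //; exact: gradedN. Qed.

Lemma graded_sum v (I : Type) (r : seq I) (Q : pred I) (F : I -> R -> {poly R}) :
  (forall i, Q i -> graded v (F i)) -> graded v (fun h => \sum_(i <- r | Q i) F i h).
Proof.
move=> hF; elim: r => [|i r IH].
  by apply: graded_eq (graded0 v) => h _; rewrite big_nil.
case Qi: (Q i); last by apply: graded_eq IH => h _; rewrite big_cons Qi.
by apply: graded_eq (gradedD (hF i Qi) IH) => h _; rewrite big_cons Qi.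
Qed.

(** Integration in [x] shifts indices by one, and the factor [h] pays for the shift; in the variable
    t = x h this is plain integration from 0. *)
Lemma graded_prim v p : graded v p -> graded v.+1 (fun h => h *: prim (p h)).
Proof.
move=> [[D hD] hv [C C0 hC]]; split.
- exists D.+1 => h Sh; rewrite (leq_trans (size_scale_leq _ _)) //.
  by rewrite (leq_trans (size_poly _ _)) // ltnS hD.
- move=> h [|i] Sh iv; rewrite coefZ coef_prim ?invr0 ?mulr0 //=.
  by rewrite hv // mul0r mulr0.
- exists C => // h [|i] Sh; rewrite coefZ coef_prim.
    by rewrite invr0 !mulr0 normr0 mulr_ge0 ?S_exp_ge0.
  rewrite normrM ger0_norm ?S_ge0 // exprS mulrCA ler_wpM2l ?S_ge0 //= normrM.
  rewrite (le_trans _ (hC h i Sh)) // ler_piMr //.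
  by rewrite ger0_norm ?invr_ge0 // invf_le1 ?ltr0n // ler1n.
Qed.

Lemma graded_functional (T : Type) (X : set T) (L : T -> {poly R} -> R) m p :
  (forall x, scalar (L x)) ->
  (forall i, exists B, forall x, X x -> `|L x 'X^i| <= B) ->
  (forall h i x, S h -> X x -> (i < m)%N -> (p h)`_i * L x 'X^i = 0) ->
  graded 0 p -> bigO X m (fun h x => L x (p h)).
Proof.
move=> lin /choice[B hB] van [[D hD] _ [C C0 hC]].
apply: (@bigO_eq _ _ _ (fun h x => \sum_(i < D) (p h)`_i * L x 'X^i)).
  by move=> h x Sh _; rewrite -scalar_expand ?hD.
apply: bigO_sum => i _; exists (C * `|B i|); first by rewrite mulr_ge0.
move=> h x Sh Xx; have [im|mi] := ltnP i m.
  by rewrite van // normr0 !mulr_ge0 // S_exp_ge0.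
rewrite normrM mulrAC ler_pM //; last by rewrite (le_trans (hB i x Xx)) ?ler_norm.
by rewrite (le_trans (hC _ _ Sh)) // ler_wpM2l // ler_wiXn2l ?S_ge0 ?S_le1.
Qed.

(** The source of nearly all orders below: only monomials of degree at least [m] survive, and they
    carry coefficients O(h^m). *)
Lemma graded_functional1 (L : {poly R} -> R) m p : scalar L ->
  (forall i, (i < m)%N -> L 'X^i = 0) -> graded 0 p ->
  bigO [set: unit] m (fun h _ => L (p h)).
Proof.
move=> lin van; apply: (@graded_functional _ _ (fun=> L)) => // [i|h i x _ _ im].
  by exists `|L 'X^i|.
by rewrite van ?mulr0.
Qed.

(** * Functions approximated by graded polynomials *)

Variable K : R.
Let X := [set x : R | `|x| <= K].

Lemma graded_eval v p : graded v p -> bigO X v (fun h x => (p h).[x]).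
Proof.
move=> hp; have [_ hv _] := hp.
apply: (@graded_functional _ _ (fun (x : R) (r : {poly R}) => r.[x]));
  last exact: graded_le hp.
- by move=> x a q r; rewrite hornerD hornerZ.
- move=> i; exists (K ^+ i) => x Xx.
  by rewrite hornerXn normrX lerXn2r ?nnegrE // (le_trans _ Xx).
- by move=> h i x Sh _ iv; rewrite hv ?mul0r.
Qed.

(** A derivative-free form of having a Taylor expansion in t = x h up to order [n], uniform for [x]
    in [-K, K]. *)
Definition approx n (phi : R -> R -> R) :=
  exists2 p, graded 0 p & bigO X n (fun h x => phi h x - (p h).[x]).

Lemma approx_graded n p : graded 0 p -> approx n (fun h x => (p h).[x]).
Proof. by exists p => //; apply: bigO_eq (bigO0 X n) => h x _ _; rewrite subrr. Qed.

Lemma approx_eq n phi psi : (forall h x, S h -> X x -> phi h x = psi h x) ->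
  approx n phi -> approx n psi.
Proof. by move=> e [p gp hp]; exists p => //; apply: bigO_eq hp => h x Sh Xx;
  rewrite e. Qed.

Lemma approx_near n phi psi : bigO X n (fun h x => phi h x - psi h x) ->
  approx n psi -> approx n phi.
Proof.
move=> e [p gp hp]; exists p => //; apply: bigO_eq (bigOD e hp) => h x _ _.
by rewrite addrA subrK.
Qed.

Lemma approx_bounded n phi : approx n phi -> bigO X 0 phi.
Proof.
move=> [p gp hp]; apply: bigO_eq (bigOD (bigO_le (leq0n n) hp) (graded_eval gp))
  => h x _ _.
by rewrite subrK.
Qed.

Lemma approx_zero phi : bigO X 0 phi -> approx 0 phi.
Proof.
by move=> hp; exists (fun=> 0); [exact: graded0|apply: bigO_eq hp => h x _ _;
  rewrite horner0 subr0].
Qed.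

Lemma approx_const n (a : R -> R) : bigO [set: unit] 0 (fun h _ => a h) ->
  approx n (fun h _ => a h).
Proof.
move=> /graded_const ga; apply: approx_eq (approx_graded n ga) => h x _ _.
by rewrite hornerC.
Qed.

Lemma approx_cst n (a : R) : approx n (fun _ _ => a).
Proof. by apply: approx_const; exact: bigO_cst. Qed.

Lemma approxD n phi psi : approx n phi -> approx n psi ->
  approx n (fun h x => phi h x + psi h x).
Proof.
move=> [p gp hp] [q gq hq]; exists (fun h => p h + q h); first exact: gradedD.
by apply: bigO_eq (bigOD hp hq) => h x _ _; rewrite hornerD; ring.
Qed.

Lemma approxM n phi psi : approx n phi -> approx n psi ->
  approx n (fun h x => phi h x * psi h x).
Proof.
move=> hphi [q gq hq]; have [p gp hp] := hphi.
exists (fun h => p h * q h); first exact: graded0M.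
apply: bigO_eq (bigOD (bigOMl (approx_bounded hphi) hq) (bigOMr hp (graded_eval gq))).
by move=> h x _ _; rewrite hornerM; ring.
Qed.

Lemma approx_sum n (I : Type) (r : seq I) (Q : pred I) (F : I -> R -> R -> R) :
  (forall i, Q i -> approx n (F i)) ->
  approx n (fun h x => \sum_(i <- r | Q i) F i h x).
Proof.
move=> hF; elim: r => [|i r IH].
  by apply: approx_eq (approx_cst n 0) => h x _ _; rewrite big_nil.
case Qi: (Q i); last by apply: approx_eq IH => h x _ _; rewrite big_cons Qi.
by apply: approx_eq (approxD (hF i Qi) IH) => h x _ _; rewrite big_cons Qi.
Qed.

Lemma approx_exp n phi i : approx n phi -> approx n (fun h x => phi h x ^+ i).
Proof.
move=> hp; elim: i => [|i IH]; first exact: approx_cst.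
by apply: approx_eq (approxM hp IH) => h x _ _; rewrite exprS.
Qed.

Lemma bigO_continuous (T : Type) (Y : set T) g (a : R -> T -> R) : continuous g ->
  bigO Y 0 a -> bigO Y 0 (fun h y => g (a h y)).
Proof.
move=> cg [M M0 hM]; have [C C0 hC] := continuous_bound M cg.
by exists C => // h y Sh Yy; rewrite expr0 mulr1 hC // -[M]mulr1 -(expr0 h) hM.
Qed.

(** For positive order, expand [g] at the constant coefficient [a h] of the approximating
    polynomial. Removing it leaves a polynomial vanishing at 0, so [phi - a] is O(h) and the Taylor
    remainder has the required order. At order 0 only boundedness is claimed. *)
Lemma approx_comp n g phi : is_Cn n g -> approx n phi ->
  approx n (fun h x => g (phi h x)).
Proof.
case: n => [|n] hg hphi.
  apply: approx_zero; apply: bigO_continuous (approx_bounded hphi).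
  exact: is_Cn_continuous hg.
have [p gp hp] := hphi.
pose a h := (p h)`_0.
have ba : bigO [set: unit] 0 (fun h _ => a h).
  by apply: (@graded_functional1 (fun r => r`_0)) gp => // u q r; rewrite coefD coefZ.
have ga := graded_const ba.
have g1 : graded 1 (fun h => p h - (a h)%:P).
  have [? _ ?] := gradedB gp ga; split=> // h [|//] _ _.
  by rewrite coefB coefC subrr.
have ha : bigO X 1 (fun h x => phi h x - a h).
  apply: bigO_eq (bigOD (bigO_le _ hp) (graded_eval g1)) => // h x _ _.
  by rewrite hornerD hornerN hornerC; ring.
have aa : approx n.+1 (fun h x => phi h x - a h).
  apply: approxD => //; apply: approx_const; exact: bigON.
have [Mp Mp0 hMp] := approx_bounded hphi; have [Ma Ma0 hMa] := ba.
pose M := Mp + Ma.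
have [C C0 hC] := taylor_bound M hg.
apply: (@approx_near _ _ (fun h x => (taylor n.+1 g (a h)).[phi h x])).
  apply: (@bigO_abs _ _ _ _ (fun h x => C * (phi h x - a h) ^+ n.+1)); last first.
    by apply: bigOMl; [exact: bigO_cst|exact: bigO_exp].
  move=> h x Sh Xx; rewrite normrM normrX (ger0_norm C0); apply: hC.
    rewrite (le_trans (hMa h tt Sh I)) // expr0 mulr1 /M; lra.
  by rewrite (le_trans (hMp h x Sh Xx)) // expr0 mulr1 /M; lra.
apply: (@approx_eq _
  (fun h x => \sum_(i < n.+1) derive1n i g (a h) / i`!%:R * (phi h x - a h) ^+ i)).
  by move=> h x _ _; rewrite taylorE.
apply: approx_sum => i _; apply: approxM; last exact: approx_exp.
apply: approx_const; apply: bigOMr; last exact: bigO_cst.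
apply: (@bigO_continuous _ _ _ (fun h _ => a h)) ba.
by case: (is_CnW (ltnW (ltn_ord i)) hg).
Qed.

End Families.

(** * Regularity of the step polynomials *)

(* The semi-discrete wave field and the gradient of its Hamiltonian are both of
   this form. *)
Definition semilin (R : realType) d (L B : 'I_d -> 'I_d -> R) (g : R -> R)
    (z : 'I_d -> R) (l : 'I_d) : R :=
  \sum_m (L l m * z m + B l m * g (z m)).

Section Step.
Variables (R : realType) (S : set R) (K : R).
Hypothesis S01 : forall h, S h -> 0 < h <= 1.
Hypothesis K1 : 1 <= K.
Let X := [set x : R | `|x| <= K].
Let S1 := [set: unit].

Lemma approx_semilin d (L B : 'I_d -> 'I_d -> R) g n (phi : 'I_d -> R -> R -> R) l :
  is_Cn n g -> (forall m, approx S K n (phi m)) ->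
  approx S K n (fun h x => semilin L B g (fun m => phi m h x) l).
Proof.
move=> hg hphi; apply: approx_sum => // m _; apply: approxD => //.
  by apply: approxM => //; exact: approx_cst.
by apply: approxM => //; [exact: approx_cst|exact: approx_comp].
Qed.

Lemma bigO_horner n (a : R -> {poly R}) D :
  (forall h, S h -> (size (a h) <= D)%N) ->
  (forall i, bigO S S1 n (fun h _ => (a h)`_i)) -> bigO S X n (fun h x => (a h).[x]).
Proof.
move=> sa ha; apply: (@bigO_eq _ _ _ _ _ (fun h x => \sum_(i < D) (a h)`_i * x ^+ i)).
  by move=> h x Sh _; rewrite (horner_coef_wide _ (sa h Sh)).
apply: bigO_sum => i _; apply: bigOMr => //.
  by apply: (bigO_comp (f := fun=> tt)) (ha i).
exists (K ^+ i) => [|h x _ Xx]; first by rewrite exprn_ge0 // (le_trans ler01).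
by rewrite expr0 mulr1 normrX lerXn2r ?nnegrE // (le_trans _ Xx).
Qed.

Lemma bigO_integral n (q : {poly R}) (a : R -> {poly R}) D :
  (forall h, S h -> (size (a h) <= D)%N) ->
  (forall i, bigO S S1 n (fun h _ => (a h)`_i)) ->
  bigO S S1 n (fun h _ => integral01 (a h * q)).
Proof.
move=> sa ha.
apply: (@bigO_eq _ _ _ _ _
  (fun h _ => \sum_(i < D) (a h)`_i * integral01 ('X^i * q))).
  move=> h x Sh _; rewrite [RHS](scalar_expand (L := fun p => integral01 (p * q))
    _ (sa h Sh)) //.
  by move=> t u v; rewrite mulrDl -scalerAl integral01D integral01Z.
by apply: bigO_sum => i _; apply: bigOMr; [exact: ha|exact: bigO_cst].
Qed.

Lemma graded_coef p i : graded S 0 p -> bigO S S1 i (fun h _ => (p h)`_i).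
Proof. by case=> _ _ [C C0 hC]; exists C => // h _ Sh _; exact: hC. Qed.

Lemma graded_of_coef (p : R -> {poly R}) D :
  (forall h, S h -> (size (p h) <= D)%N) ->
  (forall i, (i < D)%N -> bigO S S1 i (fun h _ => (p h)`_i)) -> graded S 0 p.
Proof.
move=> sp hp; split=> //; first by exists D.
have /choice[C hC] : forall i, exists C, 0 <= C /\ forall h, S h ->
  `|(p h)`_i| <= C * h ^+ i.
  move=> i; have [iD|Di] := ltnP i D.
    by have [C C0 hC] := hp i iD; exists C; split=> // h Sh; apply: (hC h tt).
  exists 0; split=> // h Sh; rewrite mul0r nth_default ?normr0 //.
  exact: leq_trans (sp h Sh) Di.
exists (\sum_(i < D) C i) => [|h i Sh]; first by apply: sumr_ge0 => i _; case: (hC i).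
have h0 : 0 <= h ^+ i by apply: exprn_ge0; case/andP: (S01 Sh) => /ltW.
have [iD|Di] := ltnP i D.
  apply: (le_trans ((hC i).2 h Sh)); rewrite ler_wpM2r // (bigD1 (Ordinal iD)) //=.
  by rewrite lerDl; apply: sumr_ge0 => j _; case: (hC j).
rewrite nth_default ?normr0; last exact: leq_trans (sp h Sh) Di.
by rewrite mulr_ge0 // sumr_ge0 // => j _; case: (hC j).
Qed.

Variables (P : nat -> {poly R}) (k s : nat) (c b : 'I_k -> R).
Hypotheses (HP : orthonormal_legendre P) (Hcb : gauss_legendre P c b).
Hypothesis sk : (s <= k)%N.
(* The nodes need not be known to lie in [0, 1]: the HBVM equations are polynomial
   identities, so they also hold outside of it. *)
Hypothesis cK : forall i, `|c i| <= K.

Lemma size_legendre_mulXn j i : (size (P j * 'X^i)%R <= j + i.+1)%N.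
Proof.
by rewrite (leq_trans (size_polyMleq _ _)) // (size_legendre HP) size_polyXn.
Qed.

(** On the graded part, monomials of degree i < j contribute nothing: the formula is exact for
    [P j * 'X^i], as i + j < 2k, and [P j] is orthogonal to them. The rest is O(h^n) at the
    nodes. *)
Lemma quad_legendre n j (phi : R -> R -> R) : (j <= k)%N -> approx S K n phi ->
  bigO S S1 (minn j n) (fun h _ => \sum_(i < k) b i * (P j).[c i] * phi h (c i)).
Proof.
move=> jk [p gp hp].
apply: (@bigO_eq _ _ _ _ _ (fun h _ => quad c b (P j * p h)
    + \sum_(i < k) b i * (P j).[c i] * (phi h (c i) - (p h).[c i]))).
  move=> h _ Sh _; rewrite /quad -big_split /=; apply: eq_bigr => i _.
  by rewrite hornerM; ring.
apply: bigOD.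
  apply: (bigO_le S01 (geq_minl _ _)).
  apply: (graded_functional1 S01 (L := fun r : {poly R} => quad c b (P j * r)))
    => // [t u v|i ij].
    by rewrite mulrDr -scalerAr (quad_is_scalar c b).
  rewrite (quad_exact HP Hcb) ?(legendre_ortho HP) ?size_polyXn //.
  by rewrite (leq_trans (size_legendre_mulXn _ _)) // leq_add // (leq_trans ij).
apply: (bigO_le S01 (geq_minr _ _)); apply: bigO_sum => i _.
apply: bigOMl; first exact: bigO_cst.
by apply: (bigO_comp (f := fun=> c i)) hp => _ _; exact: cK.
Qed.

(** * Coefficients and residual of the step polynomials *)

Section Method.
Variables (d : nat) (L B : 'I_d -> 'I_d -> R) (g : R -> R).
Variable U : 'I_d -> R -> {poly R}.
Notation F := (semilin L B g).

(** Component [l] of the [j]-th coefficient of the method, in the scaled variable x = t / h; [slope]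
    is the time derivative of the step polynomial in that variable. *)
Definition gam l j h : R :=
  \sum_(i < k) b i * (P j).[c i] * F (fun m => (U m h).[c i]) l.

Definition slope l h : {poly R} := \sum_(j < s) gam l j h *: P j.

Hypothesis g_regular : is_Cn (k + k).+1 g.
Hypothesis U_size : forall l h, S h -> (size (U l h) <= s.+1)%N.
Hypothesis U_deriv : forall l h, S h -> (U l h)^`() = h *: slope l h.
Hypothesis U_bounded : exists M, forall l h x, S h -> 0 <= x <= 1 ->
  `|(U l h).[x]| <= M.

(** Only [P j] with i <= j reach the coefficient of index [i] of the slope, and their factors [gam]
    are O(h^min(j, n)); integrating raises the index and brings one more [h]. *)
Lemma U_coef n l i : (n <= s.+1)%N -> bigO S S1 (minn i n) (fun h _ => (U l h)`_i).
Proof.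
elim: n l i => [|n IH] l i ns.
  rewrite minn0; have [M hM] := U_bounded; have [C C0 hC] := coef_bound HP s.+1.
  exists `|C * M| => // h _ Sh _; rewrite expr0 mulr1 (le_trans _ (ler_norm _)) //.
  by apply: hC => [|x hx]; [exact: U_size|exact: hM].
case: i => [|i]; first by have := IH l 0%N (ltnW ns); rewrite !min0n.
have apU m : approx S K n (fun h x => (U m h).[x]).
  (* Coefficients below [n] are graded by induction; the others are O(h^n) and go into the error. *)
  exists (fun h => take_poly n (U m h)).
    apply: (@graded_of_coef _ n) => [h _|i' i'n]; first exact: size_take_poly.
    have := IH m i' (ltnW ns); rewrite (minn_idPl (ltnW i'n)); apply: bigO_eq.
    by move=> h _ _ _; rewrite coef_take_poly i'n.
  apply: (@bigO_eq _ _ _ _ _ (fun h x => (U m h - take_poly n (U m h)).[x])).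
    by move=> h x _ _; rewrite hornerD hornerN.
  apply: (@bigO_horner _ _ (maxn s.+1 n)) => [h Sh|i'].
    rewrite (leq_trans (size_polyD _ _)) // size_polyN geq_max !leq_max U_size //=.
    by rewrite size_take_poly orbT.
  have [i'n|ni'] := ltnP i' n.
    apply: bigO_eq (bigO0 S S1 n) => h _ _ _.
    by rewrite coefB coef_take_poly i'n subrr.
  have := IH m i' (ltnW ns); rewrite (minn_idPr ni'); apply: bigO_eq => h _ _ _.
  by rewrite coefB coef_take_poly ltnNge ni' subr0.
have gn : is_Cn n g by apply: is_CnW g_regular; lia.
have hgam j : (j < s)%N -> bigO S S1 (minn j n) (fun h _ => gam l j h).
  move=> js; apply: (@quad_legendre n j (fun h x => F (fun m => (U m h).[x]) l));
    first by lia.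
  exact: approx_semilin.
apply: (@bigO_eq _ _ _ _ _
  (fun h _ => i.+1%:R^-1 * (h * \sum_(j < s) gam l j h * (P j)`_i))).
  move=> h _ Sh _; have /(congr1 (fun r : {poly R} => r`_i)) := U_deriv l Sh.
  rewrite coef_deriv coefZ coef_sum => E.
  under eq_bigr do rewrite -coefZ.
  by rewrite -E -[X in _ * X = _]mulr_natl mulrA mulVf ?mul1r // pnatr_eq0.
apply: bigOMl; first exact: bigO_cst.
apply: (@bigO_le _ _ S01 _ _ _ (1 + minn i n)); first by lia.
apply: bigOM; first exact: bigO_step.
apply: bigO_sum => j _; have [ji|ij] := ltnP j i.
  apply: bigO_eq (bigO0 S S1 _) => h _ _ _.
  by rewrite nth_default ?mulr0 // (size_legendre HP).
apply: bigOMr; last exact: bigO_cst.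
by apply: (bigO_le S01) (hgam j _) => //; lia.
Qed.

Lemma U_graded l : graded S 0 (U l).
Proof.
apply: (@graded_of_coef _ s.+1) => [h|i si]; first exact: U_size.
by have := U_coef l i (leqnn _); rewrite (minn_idPl (ltnW si)).
Qed.

Lemma U_approx n l : approx S K n (fun h x => (U l h).[x]).
Proof. exact/approx_graded/U_graded. Qed.

Lemma gam_bigO l j : (j < s)%N -> bigO S S1 j (fun h _ => gam l j h).
Proof.
move=> js; have gj : is_Cn j g by apply: is_CnW g_regular; lia.
have := @quad_legendre j j (fun h x => F (fun m => (U m h).[x]) l); rewrite minnn.
apply; first by lia.
by apply: approx_semilin => // m; exact: U_approx.
Qed.

Lemma slope_size l h : (size (slope l h) <= s)%N.
Proof.
apply: (leq_trans (size_sum _ _ _)); apply/bigmax_leqP => j _.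
by rewrite (leq_trans (size_scale_leq _ _)) // (size_legendre HP).
Qed.

Lemma slope_graded l : graded S 0 (slope l).
Proof.
apply: (@graded_of_coef _ s) => [h _|i si]; first exact: slope_size.
apply: (@bigO_eq _ _ _ _ _ (fun h _ => \sum_(j < s) gam l j h * (P j)`_i)).
  by move=> h _ _ _; rewrite coef_sum; apply: eq_bigr => j _; rewrite coefZ.
apply: bigO_sum => j _; have [ji|ij] := ltnP j i.
  apply: bigO_eq (bigO0 S S1 _) => h _ _ _.
  by rewrite nth_default ?mulr0 // (size_legendre HP).
apply: bigOMr; last exact: bigO_cst.
exact: (bigO_le S01 ij) (gam_bigO _ _).
Qed.

(** Take [r] as the slope minus a graded approximation [p] of the field along [U]. The slope has the
    quadrature values [gam] as its Legendre coefficients, so the first [s] moments of [r] are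
    quadrature errors. *)
Lemma residual l : exists r : R -> {poly R},
  [/\ graded S 0 r, forall i, bigO S S1 s (fun h _ => (r h)`_i),
    bigO S X (k + k)
      (fun h x => (slope l h).[x] - F (fun m => (U m h).[x]) l - (r h).[x])
  & forall w, graded S 0 w -> bigO S S1 (s + s) (fun h _ => integral01 (w h * r h))].
Proof.
have gkk : is_Cn (k + k) g by apply: is_CnW g_regular.
have aF : approx S K (k + k) (fun h x => F (fun m => (U m h).[x]) l).
  by apply: approx_semilin => // m; exact: U_approx.
have [p gp hp] := aF.
pose r h := slope l h - p h.
have gr : graded S 0 r by apply: gradedB => //; exact: slope_graded.
have rE h : r h = slope l h - p h by [].
clearbody r.
have [[D hD] _ _] := gr.
(* Quadrature is exact on [P j * 'X^i] for i < 2k - j, so the error on [P j * p] is O(h^(2k-j)). *)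
have momP j : (j < s)%N -> bigO S S1 (k + k - j) (fun h _ => integral01 (r h * P j)).
  move=> js.
  apply: (@bigO_eq _ _ _ _ _
    (fun h _ => (quad c b (P j * p h) - integral01 (P j * p h))
    + \sum_(i < k) b i * (P j).[c i] * (F (fun m => (U m h).[c i]) l - (p h).[c i]))).
    move=> h _ Sh _; rewrite rE mulrBl integral01B.
    have -> : integral01 (slope l h * P j) = gam l j h.
      rewrite mulr_suml integral01_sum (bigD1 (Ordinal js)) //= -scalerAl
        integral01Z HP.2 eqxx.
      rewrite mulr1 big1 ?addr0 // => i ij; rewrite -scalerAl integral01Z HP.2.
      by rewrite -val_eqE /= in ij; rewrite (negPf ij) mulr0.
    rewrite [P j * p h]mulrC.
    rewrite addrAC; congr (_ - _); rewrite /quad -big_split /=; apply: eq_bigr => i _.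
    by rewrite hornerM; ring.
  apply: bigOD.
    apply: (graded_functional1 S01 (L := fun q : {poly R} => quad c b (P j * q) -
      integral01 (P j * q))) => //.
      move=> t u v; rewrite mulrDr -scalerAr (quad_is_scalar c b) integral01D
        integral01Z.
      by ring.
    move=> i ij; rewrite (quad_exact HP Hcb) ?subrr //.
    by rewrite (leq_trans (size_legendre_mulXn _ _)) //; lia.
  apply: (bigO_le S01 (leq_subr _ _)); apply: bigO_sum => i _.
  apply: bigOMl; first exact: bigO_cst.
  by apply: (bigO_comp (f := fun=> c i)) hp => _ _; exact: cK.
have momX i : (i < s)%N -> bigO S S1 (k + k - i) (fun h _ => integral01 (r h * 'X^i)).
  move=> si; have [a ->] : exists a : nat -> R, 'X^i = \sum_(j < i.+1) a j *: P j.
    by apply: (legendre_span HP); rewrite size_polyXn.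
  apply: (@bigO_eq _ _ _ _ _
    (fun h _ => \sum_(j < i.+1) a j * integral01 (r h * P j))).
    move=> h _ _ _; rewrite mulr_sumr integral01_sum; apply: eq_bigr => j _.
    by rewrite -scalerAr integral01Z.
  apply: bigO_sum => j _; apply: bigOMl; first exact: bigO_cst.
  by apply: (bigO_le S01) (momP j _); have := ltn_ord j; lia.
(* Coefficients from index [s] on are small by grading. Hence the truncation of [r] below [s]
   inherits the small moments, and its Legendre expansion recovers it from them. *)
have rs i : bigO S S1 s (fun h _ => (r h)`_i).
  have [si|si] := leqP s i; first exact: (bigO_le S01 si) (graded_coef i gr).
  apply: (@bigO_eq _ _ _ _ _ (fun h _ =>
      \sum_(j < s) integral01 (take_poly s (r h) * P j) * (P j)`_i)).
    move=> h _ _ _; have := legendre_expand HP (size_take_poly s (r h)).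
    move/(congr1 (fun q : {poly R} => q`_i));
      rewrite coef_take_poly si coef_sum => ->.
    by apply: eq_bigr => j _; rewrite coefZ.
  apply: bigO_sum => j _; apply: bigOMr; last exact: bigO_cst.
  apply: (@bigO_eq _ _ _ _ _ (fun h _ => integral01 (r h * P j)
      - integral01 ((r h - take_poly s (r h)) * P j))).
    move=> h _ _ _; rewrite mulrBl integral01B.
    by ring.
  apply: bigOB; first by apply: (bigO_le S01) (momP j _); have := ltn_ord j; lia.
  apply: (@bigO_integral _ _ _ (maxn D s)) => [h Sh|i'].
    rewrite (leq_trans (size_polyD _ _)) // size_polyN geq_max !leq_max hD //=.
    by rewrite size_take_poly orbT.
  have [i's|si'] := ltnP i' s.
    apply: bigO_eq (bigO0 S S1 s) => h _ _ _.
    by rewrite coefB coef_take_poly i's subrr.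
  apply: bigO_eq (bigO_le S01 si' (graded_coef i' gr)) => h _ _ _.
  by rewrite coefB coef_take_poly ltnNge si' subr0.
exists r; split=> //.
  apply: bigO_eq (bigON hp) => h x _ _; by rewrite rE hornerD hornerN; ring.
move=> w gw; have [[Dw hDw] _ _] := gw.
apply: (@bigO_eq _ _ _ _ _
  (fun h _ => \sum_(i < Dw) (w h)`_i * integral01 (r h * 'X^i))).
  move=> h _ Sh _.
  rewrite [RHS](scalar_expand (L := fun p => integral01 (p * r h)) _ (hDw h Sh)).
    by apply: eq_bigr => i _; rewrite ['X^i * _]mulrC.
  by move=> t u v; rewrite mulrDl -scalerAl integral01D integral01Z.
(* For i < s the orders add up to i + (2k - i) = 2k; for larger [i], [w] gives h^i and [r] gives
   h^s. *)
apply: bigO_sum => i _; have [si|si] := ltnP i s.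
  apply: (@bigO_le _ _ S01 _ _ _ (i + (k + k - i))); first by lia.
  by apply: bigOM; [exact: graded_coef|exact: momX].
apply: (@bigO_le _ _ S01 _ _ _ (i + s)); first by lia.
apply: bigOM; first exact: graded_coef.
exact: (@bigO_integral _ _ _ D).
Qed.

End Method.
End Step.

(** * Order of convergence *)

Section Convergence.
Variables (R : realType) (S : set R) (K : R).
Hypothesis S01 : forall h, S h -> 0 < h <= 1.
Hypothesis K1 : 1 <= K.
Let X := [set x : R | `|x| <= K].
Let S1 := [set: unit].
Let I01 := [set x : R | 0 <= x <= 1].

Let I01X x : I01 x -> X x.
Proof. by rewrite /I01 /X /= => /andP[x0 x1]; rewrite ger0_norm // (le_trans x1). Qed.

(** Stands in for integrating a bound over the step; differentiability is asked only inside the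
    interval, where the exact solution provides it. *)
Lemma bigO_mean_value n (phi dphi : R -> R -> R) :
  (forall h, S h -> phi h 0 = 0) ->
  (forall h, S h -> {within `[0, 1], continuous (phi h)}) ->
  (forall h (x : R), S h -> 0 < x < 1 -> is_derive x 1 (phi h) (dphi h x)) ->
  bigO S I01 n dphi -> bigO S I01 n phi.
Proof.
move=> phi0 cphi derphi [C C0 hC]; exists C => // h x Sh /andP[x0 x1].
have [y||] := @MVT_segment R (phi h) (dphi h) 0 x x0.
- rewrite in_itv /= => /andP[y0 yx]; apply: derphi => //.
  by rewrite y0 (lt_le_trans yx).
- apply: continuous_subspaceW (cphi h Sh) => y /=; rewrite !in_itv /= => /andP[-> yx].
  exact: le_trans yx x1.
move=> y; rewrite in_itv /= phi0 // !subr0 => /andP[y0 yx] ->.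
rewrite normrM (ger0_norm x0) (le_trans (ler_piMr _ x1)) //.
by apply: hC => //; rewrite /I01 /= y0 (le_trans yx).
Qed.

(** The distance O(h^m) enters the remainder to the power [n]. With [n = 1] this is a Lipschitz
    estimate, with [n = 2] the quadratic remainder of a linearization. *)
Lemma bigO_taylor (T : Type) (Z : set T) n m g (phi psi : R -> T -> R) : is_Cn n g ->
  bigO S Z 0 phi -> bigO S Z 0 psi -> bigO S Z m (fun h x => psi h x - phi h x) ->
  bigO S Z (m * n) (fun h x => g (psi h x) - (taylor n g (phi h x)).[psi h x]).
Proof.
move=> hg [M M0 hM] [M' M'0 hM'] [D D0 hD].
have [C C0 hC] := taylor_bound (M + M') hg.
exists (C * D ^+ n) => [|h x Sh Zx]; first by rewrite mulr_ge0 ?exprn_ge0.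
have hphi : `|phi h x| <= M + M'.
  by rewrite (le_trans (hM h x Sh Zx)) // expr0 mulr1 lerDl.
have hpsi : `|psi h x| <= M + M'.
  by rewrite (le_trans (hM' h x Sh Zx)) // expr0 mulr1 lerDr.
rewrite (le_trans (hC _ _ hphi hpsi)) // -mulrA ler_wpM2l // exprM -exprMn.
have h0 : 0 <= h by case/andP: (S01 Sh) => /ltW.
by rewrite lerXn2r ?nnegrE ?mulr_ge0 ?exprn_ge0 // hD.
Qed.

Variables (P : nat -> {poly R}) (k s : nat) (c b : 'I_k -> R).
Hypotheses (HP : orthonormal_legendre P) (Hcb : gauss_legendre P c b).
Hypothesis s1 : (0 < s)%N.
Hypothesis sk : (s <= k)%N.
Hypothesis cK : forall i, `|c i| <= K.

Variables (d : nat) (L B : 'I_d -> 'I_d -> R) (g : R -> R).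
Variable U : 'I_d -> R -> {poly R}.
Notation F := (semilin L B g).
Notation slope := (slope P s c b L B g U).

Hypothesis g_regular : is_Cn (k + k).+1 g.
Hypothesis U_size : forall l h, S h -> (size (U l h) <= s.+1)%N.
Hypothesis U_deriv : forall l h, S h -> (U l h)^`() = h *: slope l h.
Hypothesis U_bounded : exists M, forall l h x, S h -> 0 <= x <= 1 ->
  `|(U l h).[x]| <= M.

Variable Y : 'I_d -> R -> R -> R.
Hypothesis Y_init : forall l h, S h -> Y l h 0 = (U l h).[0].
Hypothesis Y_cont : forall l h, S h -> {within `[0, 1], continuous (Y l h)}.
Hypothesis Y_deriv : forall l h (x : R), S h -> 0 < x < 1 ->
  is_derive x 1 (Y l h) (h * F (fun m => Y m h x) l).
Hypothesis Y_bounded : forall l, bigO S I01 0 (Y l).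

Let err l h x := (U l h).[x] - Y l h x.

Let step_graded l : graded S 0 (U l).
Proof.
exact: (U_graded S01 K1 HP Hcb sk cK (L := L) (B := B) g_regular U_size U_deriv
  U_bounded l).
Qed.

Let eval_I01 v p : graded S v p -> bigO S I01 v (fun h x => (p h).[x]).
Proof. by move=> gp; apply: (bigO_comp (f := id)) (graded_eval S01 K gp). Qed.

Let bigO_one n phi : bigO S I01 n phi -> bigO S S1 n (fun h _ => phi h 1).
Proof. by apply: (bigO_comp (f := fun=> 1)) => _ _; rewrite /I01 /= lexx ler01. Qed.

Let err_deriv l h (x : R) : S h -> 0 < x < 1 ->
  is_derive x 1 (err l h) (h * ((slope l h).[x] - F (fun m => Y m h x) l)).
Proof.
move=> Sh x01; rewrite mulrBr; apply: is_deriveB; last exact: Y_deriv.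
by rewrite -hornerZ -U_deriv //; exact: is_derive_horner.
Qed.

Let horner_cont p : {within `[0, 1], continuous (horner p : R -> R)}.
Proof. by apply: continuous_subspaceT => y; exact: continuous_horner. Qed.

Let err_cont l h : S h -> {within `[0, 1], continuous (err l h)}.
Proof.
by move=> Sh x; apply: cvgB; [exact: horner_cont|exact: Y_cont].
Qed.

Let err_init l h : S h -> err l h 0 = 0.
Proof. by move=> Sh; rewrite /err Y_init ?subrr. Qed.

Let UI01 l : bigO S I01 0 (fun h x => (U l h).[x]).
Proof. exact: eval_I01. Qed.

Lemma residual_I01 l : exists r : R -> {poly R},
  [/\ graded S 0 r, bigO S I01 s (fun h x => (r h).[x]),
    bigO S I01 (k + k)
      (fun h x => (slope l h).[x] - F (fun m => (U m h).[x]) l - (r h).[x])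
  & forall w, graded S 0 w -> bigO S S1 (s + s) (fun h _ => integral01 (w h * r h))].
Proof.
have [r [gr rs hr wr]] :=
  residual S01 K1 HP Hcb sk cK (L := L) (B := B) g_regular U_size U_deriv U_bounded l.
have [[D hD] _ _] := gr.
exists r; split=> //; last by apply: (bigO_comp (f := id)) hr.
by apply: (bigO_comp (f := id)) (bigO_horner K1 hD rs).
Qed.

Let err_swap m h x : Y m h x - (U m h).[x] = - err m h x.
Proof. by rewrite /err opprB. Qed.

Lemma field_lipschitz n l : (forall m, bigO S I01 n (err m)) ->
  bigO S I01 n (fun h x => F (fun m => (U m h).[x]) l - F (fun m => Y m h x) l).
Proof.
move=> he.
apply: (@bigO_eq _ _ _ _ _ (fun h x => \sum_m (L l m * err m h x
    - B l m * (g (Y m h x) - (taylor 1 g (U m h).[x]).[Y m h x])))).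
  move=> h x Sh _; rewrite -sumrB; apply: eq_bigr => m _; rewrite taylorE.
  by rewrite big_ord1 expr0 fact0 /= /err; field.
apply: bigO_sum => m _; apply: bigOB; apply: bigOMl; try exact: bigO_cst;
  first exact: he.
rewrite -[n]muln1; apply: bigO_taylor => //; first by apply: is_CnW g_regular.
by apply: bigO_eq (bigON (he m)) => h x _ _; rewrite err_swap.
Qed.

(** Each round feeds the current order through the Lipschitz bound and gains the factor [h] of the
    error equation; the size O(h^s) of the residual stops this at s + 1. *)
Lemma err_bigO n l : (n <= s.+1)%N -> bigO S I01 n (err l).
Proof.
have /choice[r hr] := residual_I01.
elim: n l => [|n IH] l ns; first by apply: bigOB; [exact: UI01|exact: Y_bounded].
apply: (@bigO_mean_value _ _
    (fun h x => h * ((slope l h).[x] - F (fun m => Y m h x) l))).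
- by move=> h; exact: err_init.
- by move=> h; exact: err_cont.
- by move=> h x; exact: err_deriv.
rewrite -add1n; apply: bigOM; first exact: bigO_step.
have [gr rs Fr _] := hr l.
have lip := field_lipschitz l (fun m => IH m (ltnW ns)).
apply: (bigO_eq _ (bigOD (bigOD (bigO_le S01 _ Fr) (bigO_le S01 _ rs)) lip)).
- by move=> h x _ _; rewrite addrAC; ring.
- by lia.
- by lia.
Qed.

(** Here [w] has derivative [- h W a], with [W] the preceding Picard iterate, and [h D] is the
    derivative of the error [E]. Against the derivative of the weighted error the terms [w a E]
    cancel, leaving the mismatch [w - W] and the linearization defect. *)
Lemma adjoint_cancel (w W D r E : 'I_d -> R) (a : 'I_d -> 'I_d -> R) h :
  h * (\sum_m (\sum_l (w l - W l) * a l m) * E m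
       + \sum_l w l * (D l - r l - \sum_m a l m * E m)) =
  \sum_m (w m * (h * D m) - h * (\sum_l W l * a l m) * E m) - h * \sum_l w l * r l.
Proof.
have swap : \sum_l w l * (\sum_m a l m * E m) = \sum_m (\sum_l w l * a l m) * E m.
  under eq_bigr do rewrite mulr_sumr; rewrite exchange_big; apply: eq_bigr => m _.
  by rewrite mulr_suml; apply: eq_bigr => l _; rewrite mulrA.
have -> : \sum_l w l * (D l - r l - \sum_m a l m * E m) =
    \sum_l w l * D l - \sum_l w l * r l - \sum_m (\sum_l w l * a l m) * E m.
  by rewrite -swap -!sumrB; apply: eq_bigr => l _; ring.
have -> : \sum_m (\sum_l (w l - W l) * a l m) * E m =
    \sum_m (\sum_l w l * a l m) * E m - \sum_m (\sum_l W l * a l m) * E m.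
  rewrite -sumrB; apply: eq_bigr => m _; rewrite -mulrBl -sumrB; congr (_ * _).
  by apply: eq_bigr => l _; rewrite mulrBl.
rewrite sumrB; under [X in _ = X - _ - _]eq_bigr do rewrite mulrCA.
under [X in _ = _ - X - _]eq_bigr do rewrite -mulrA.
by rewrite -!mulr_sumr; ring.
Qed.

Section Weights.
Variables (a : 'I_d -> 'I_d -> R -> {poly R}) (l0 : 'I_d).
Hypothesis ga : forall l m, graded S 0 (a l m).

(* Picard iterates for the adjoint equation w' = - h w a with w(0) = e_l0 (in
   the scaled variable). *)
Fixpoint weight n (m : 'I_d) (h : R) : {poly R} :=
  (l0 == m)%:R%:P -
  if n is n'.+1 then h *: prim (\sum_l weight n' l h * a l m h) else 0.

Lemma weight_graded n m :
  graded S 0 (weight n m) /\ graded S 1 (fun h => weight n m h - (l0 == m)%:R%:P).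
Proof.
have gc m' : graded S 0 (fun _ => (l0 == m')%:R%:P).
  by apply: graded_const => //; exact: bigO_cst.
elim: n m => [|n IH] m.
  split; first by apply: gradedB => //; exact: graded0.
  by apply: graded_eq (graded0 S 1) => h _ /=; rewrite subr0 subrr.
have g1 : graded S 1 (fun h => h *: prim (\sum_l weight n l h * a l m h)).
  apply: graded_prim => //; apply: graded_sum => l _.
  by apply: graded0M => //; case: (IH l).
split; first by apply: gradedB => //; exact: graded_le g1.
by apply: graded_eq (gradedN g1) => h _ /=; rewrite addrAC subrr add0r.
Qed.

(** The common initial value drops out, and each integration raises the order of the zero at 0 by
    one. *)
Lemma weight_diff n m : graded S n.+1 (fun h => weight n.+1 m h - weight n m h).
Proof.
elim: n m => [|n IH] m.
  have [_] := weight_graded 1 m; apply: graded_eq => h _.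
  by rewrite [weight 0 m h]/= subr0.
apply: (@graded_eq _ _ _ (fun h =>
    - (h *: prim (\sum_l (weight n.+1 l h - weight n l h) * a l m h)))).
  move=> h _; pose A n' := prim (\sum_l weight n' l h * a l m h).
  transitivity (h *: A n - h *: A n.+1); last by rewrite /=; ring.
  rewrite -scalerBr -scalerN; congr (_ *: _).
  apply/polyP => i; rewrite coefN coefB !coef_prim !coef_sum -mulrBl -mulNr
    -sumrN -sumrB.
  by congr (_ / _); apply: eq_bigr => l _; rewrite mulrBl coefB opprB.
apply: gradedN; apply: graded_prim => //; apply: graded_sum => l _.
by have := gradedM S01 (IH l) (ga l m); rewrite addn0.
Qed.

Lemma weight_deriv n m h :
  (weight n.+1 m h)^`() = - (h *: \sum_l weight n l h * a l m h).
Proof. by rewrite /= derivB derivC sub0r derivZ deriv_prim. Qed.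

End Weights.

(** Only the residual integrated against the weights could be larger than O(h^(2s+1)) pointwise; it
    is split off in [Z] and treated as a single integral at x = 1. *)
Lemma weighted_err l0 : exists w : 'I_d -> R -> {poly R},
  (forall m, bigO S S1 1 (fun h _ => (w m h).[1] - (l0 == m)%:R)) /\
  bigO S S1 (s + s).+1 (fun h _ => \sum_m (w m h).[1] * err m h 1).
Proof.
have /choice[r hr] := residual_I01.
have g's : is_Cn s (derive1 g).
  by apply: is_Cn_derive; apply: is_CnW g_regular; lia.
have g2 : is_Cn 2 g by apply: is_CnW g_regular; lia.
(* The Jacobian of the field along [U], replaced below by graded polynomials [a] up to O(h^s), so
   that the weights stay polynomials. *)
pose A l m h x := L l m + B l m * derive1 g (U m h).[x].
have /choice[a ha] : forall lm : 'I_d * 'I_d, exists p, graded S 0 p /\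
    bigO S I01 s (fun h x => A lm.1 lm.2 h x - (p h).[x]).
  move=> [l m] /=; have [p gp hp] : approx S K s (A l m).
    apply: approxD => //; first exact: approx_cst.
    apply: approxM => //; first exact: approx_cst.
    by apply: approx_comp => //; apply: approx_graded.
  by exists p; split=> //; apply: (bigO_comp (f := id)) hp.
pose a' l m := a (l, m).
have ga l m : graded S 0 (a' l m) by case: (ha (l, m)).
pose w := weight a' l0 s.+1.
have gw m : graded S 0 (w m) by case: (weight_graded l0 ga s.+1 m).
exists w; split=> [m|].
  have [_ /eval_I01/bigO_one] := weight_graded l0 ga s.+1 m;
    apply: bigO_eq => h _ _ _.
  by rewrite hornerD hornerN hornerC.
pose V h := \sum_l w l h * r l h.
pose Z h x := \sum_m (w m h).[x] * err m h x - h * (prim (V h)).[x].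
pose q m h x := g (Y m h x) - (taylor 2 g (U m h).[x]).[Y m h x].
pose rho l h x := (slope l h).[x] - F (fun m => (U m h).[x]) l - (r l h).[x].
pose dZ h x := h * (
  \sum_m (\sum_l ((w l h).[x] - (weight a' l0 s l h).[x]) * (a' l m h).[x]) * err m h x
  + \sum_l (w l h).[x] * (\sum_m (A l m h x - (a' l m h).[x]) * err m h x
                          - \sum_m B l m * q m h x + rho l h x)).
have erO m : bigO S I01 s.+1 (err m) by exact: err_bigO.
(* Orders inside the bracket: iterate mismatch times error 2(s+1), Jacobian defect times error s +
   (s+1), Taylor remainder 2(s+1), field approximation 2k. All are at least 2s, and the outer [h]
   adds one. *)
have dZO : bigO S I01 (s + s).+1 dZ.
  rewrite -add1n; apply: bigOM; first exact: bigO_step.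
  apply: bigOD; apply: bigO_sum => m _.
    apply: (@bigO_le _ _ S01 _ _ _ (s.+1 + s.+1)); first by lia.
    apply: bigOM => //; apply: bigO_sum => l _; apply: bigOMr.
      apply: bigO_eq (eval_I01 (weight_diff l0 ga s l)) => h x _ _.
      by rewrite hornerD hornerN.
    exact: eval_I01 (ga l m).
  apply: bigOMl; first exact: eval_I01.
  apply: bigOD; last by case: (hr m) => _ _ h _; apply: (bigO_le S01) h; lia.
  apply: bigOB; apply: bigO_sum => l _.
    apply: (@bigO_le _ _ S01 _ _ _ (s + s.+1)); first by lia.
    by apply: bigOM => //; case: (ha (m, l)).
  apply: bigOMl; first exact: bigO_cst.
  apply: (@bigO_le _ _ S01 _ _ _ (s.+1 * 2)); first by lia.
  apply: bigO_taylor => //.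
  by apply: bigO_eq (bigON (erO l)) => h x _ _; rewrite err_swap.
have Zder h (x : R) : S h -> 0 < x < 1 -> is_derive x 1 (Z h) (dZ h x).
  move=> Sh x01.
  have -> : Z h = \sum_m (fun x => (w m h).[x] * err m h x)
      - (fun x => h * (prim (V h)).[x]).
    by apply/funext => y; rewrite /Z !fctE fct_sumE.
  have hs m : is_derive x 1 (fun x => (w m h).[x] * err m h x)
      ((w m h).[x] * (h * ((slope m h).[x] - F (fun m => Y m h x) m))
       + err m h x * ((w m h)^`()).[x]).
    exact: is_deriveM (is_derive_horner (w m h) x) (err_deriv m Sh x01).
  have hp : is_derive x 1 (fun x => h * (prim (V h)).[x]) (h * (V h).[x]).
    have := is_derive_horner (prim (V h)) x; rewrite deriv_prim => hV.
    exact: is_deriveZ hV.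
  have hZ := is_deriveB (is_derive_sum hs) hp.
  apply: (is_derive_eq hZ).
  have key l : \sum_m (A l m h x - (a' l m h).[x]) * err m h x
      - \sum_m B l m * q m h x + rho l h x =
      ((slope l h).[x] - F (fun m => Y m h x) l) - (r l h).[x]
      - \sum_m (a' l m h).[x] * err m h x.
    have -> : rho l h x = (slope l h).[x] - F (fun m => Y m h x) l - (r l h).[x]
        - (F (fun m => (U m h).[x]) l - F (fun m => Y m h x) l) by rewrite /rho; ring.
    rewrite -[F _ _ - F _ _]sumrB -sumrB addrCA; congr (_ + _);
      rewrite -!sumrB -sumrN.
    apply: eq_bigr => m _; rewrite /A /q /err taylorE 2!big_ord_recr big_ord0 /=
      fact0 -[1`!]/1%N.
    by field.
  rewrite /dZ (eq_bigr _ (fun l _ => congr1 (GRing.mul _) (key l))).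
  rewrite [RHS]adjoint_cancel horner_sum; congr (_ - h * _); last first.
    by apply: eq_bigr => l _; rewrite hornerM.
  apply: eq_bigr => m _; congr (_ + _).
  rewrite weight_deriv hornerN hornerZ horner_sum mulrN mulrC.
  by under eq_bigr do rewrite hornerM.
have Z1 : bigO S S1 (s + s).+1 (fun h _ => Z h 1).
  apply/bigO_one; apply: (@bigO_mean_value _ _ dZ) => //.
  - move=> h Sh; rewrite /Z prim0E mulr0 subr0 big1 // => m _.
    by rewrite err_init ?mulr0.
  - move=> h Sh x; apply: cvgB.
      apply: cvg_big => [|m _]; first exact: add_continuous.
      apply: cvgM; [exact: horner_cont|exact: err_cont].
    by apply: cvgM; [exact: cvg_cst|exact: horner_cont].
apply: (@bigO_eq _ _ _ _ _
  (fun h _ => Z h 1 + h * \sum_l integral01 (w l h * r l h))).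
  by move=> h _ _ _; rewrite /Z -integral01E -integral01_sum subrK.
apply: bigOD => //; rewrite -add1n; apply: bigOM; first exact: bigO_step.
by apply: bigO_sum => l _; case: (hr l) => _ _ _; apply.
Qed.

(** At x = 1 the weights are a unit vector plus O(h), so component [l] is the weighted error plus
    O(h) times all components: each round gains one order, up to that of the weighted error. *)
Lemma step_error l : bigO S S1 (s + s).+1 (fun h _ => (U l h).[1] - Y l h 1).
Proof.
suff H n : (n <= (s + s).+1)%N -> forall l, bigO S S1 n (fun h _ => err l h 1).
  exact: (H _ (leqnn _)).
elim: n => [|n IH] ns {}l.
  by apply: (bigO_one (phi := err l)); exact: err_bigO.
have [w [w1 we]] := weighted_err l.
apply: (@bigO_eq _ _ _ _ _ (fun h _ => \sum_m (w m h).[1] * err m h 1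
    - \sum_m ((w m h).[1] - (l == m)%:R) * err m h 1)).
  move=> h _ _ _; rewrite -sumrB (bigD1 l) //= eqxx big1 ?addr0 => [|m ml].
    by rewrite -mulrBl subKr mul1r.
  by rewrite eq_sym (negPf ml) subr0 subrr.
apply: bigOB; first exact: (bigO_le S01 ns).
apply: bigO_sum => m _; rewrite -add1n; apply: bigOM => //; apply: IH; exact: ltnW.
Qed.

End Convergence.

(** * Energy *)

Section Energy.
Variables (R : realType) (S : set R) (K : R).
Let S1 := [set: unit].

Variables (P : nat -> {poly R}) (k s : nat) (c b : 'I_k -> R).
Hypotheses (HP : orthonormal_legendre P) (Hcb : gauss_legendre P c b).

Variables (d : nat) (L B L' B' : 'I_d -> 'I_d -> R) (g : R -> R).
Variable U : 'I_d -> R -> {poly R}.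
Notation F := (semilin L B g).
Notation G := (semilin L' B' g).
Notation slope := (slope P s c b L B g U).

Variable J : 'I_d -> 'I_d -> R.
Hypothesis J_skew : forall l m, J l m = - J m l.
Hypothesis F_hamiltonian : forall z l, F z l = \sum_m J l m * G z m.
Hypothesis U_deriv : forall l h, S h -> (U l h)^`() = h *: slope l h.

Variable E : R -> R -> R.
Hypothesis E_deriv : forall h (x : R), S h ->
  is_derive x 1 (E h) (\sum_l G (fun m => (U m h).[x]) l * (U l h)^`().[x]).

(** Expanding the slope in the [P j] turns the sum into [h] times the sum over [j] of the quadratic
    forms eta_j^T J eta_j, where eta_j is the quadrature coefficient of the gradient; each form
    equals its own negative. *)
Lemma quad_energy h : S h ->
  \sum_(i < k) b i * \sum_l G (fun m => (U m h).[c i]) l * (U l h)^`().[c i] = 0.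
Proof.
move=> Sh.
pose eta j l := \sum_(i < k) b i * (P j).[c i] * G (fun m => (U m h).[c i]) l.
have gamE l j : gam P c b L B g U l j h = \sum_m J l m * eta j m.
  rewrite /gam /eta; under eq_bigr do rewrite F_hamiltonian mulr_sumr.
  rewrite exchange_big; apply: eq_bigr => m _; rewrite mulr_sumr.
  by apply: eq_bigr => i _; ring.
transitivity (h * \sum_(j < s) \sum_l eta j l * \sum_m J l m * eta j m).
  under eq_bigr do rewrite mulr_sumr; rewrite exchange_big mulr_sumr.
  under [RHS]eq_bigr do rewrite mulr_sumr; rewrite [RHS]exchange_big.
  apply: eq_bigr => l _; rewrite /eta.
  under [RHS]eq_bigr do rewrite -gamE mulr_suml mulr_sumr; rewrite [RHS]exchange_big.
  apply: eq_bigr => i _; rewrite U_deriv // hornerZ horner_sum !mulr_sumr.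
  by apply: eq_bigr => j _; rewrite hornerZ; ring.
rewrite big1 ?mulr0 // => j _.
set T := \sum_l _; suff : T = - T by lra.
rewrite {1}/T; under eq_bigr do rewrite mulr_sumr; rewrite exchange_big -sumrN.
apply: eq_bigr => l _; rewrite mulr_sumr -sumrN; apply: eq_bigr => m _.
by rewrite J_skew; ring.
Qed.

(** Degree 2k is admissible because the formula, exact up to degree 2k - 1, is applied to the
    derivative of [q]. *)
Lemma energy_exact h (q : {poly R}) : S h -> (size q <= (k + k).+1)%N ->
  (forall x, E h x = q.[x]) ->
  E h 1 - E h 0 = 0.
Proof.
move=> Sh sq Eq; rewrite !Eq -integral01_deriv -(quad_exact HP Hcb).
  rewrite -(quad_energy Sh) /quad; apply: eq_bigr => i _; congr (_ * _).
  have -> : q^`().[c i] = 'D_1 (E h) (c i).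
    rewrite (_ : E h = horner q); last exact/funext.
    by rewrite -derive1E -derivE.
  by have [] := E_deriv (c i) Sh.
apply/leq_sizeP => i ki; rewrite coef_deriv nth_default ?mul0rn //.
by rewrite (leq_trans sq).
Qed.

Hypothesis S01 : forall h, S h -> 0 < h <= 1.
Hypothesis K1 : 1 <= K.
Hypothesis sk : (s <= k)%N.
Hypothesis cK : forall i, `|c i| <= K.
Hypothesis g_regular : is_Cn (k + k).+1 g.
Hypothesis U_size : forall l h, S h -> (size (U l h) <= s.+1)%N.
Hypothesis U_bounded : exists M, forall l h x, S h -> 0 <= x <= 1 ->
  `|(U l h).[x]| <= M.

(** Factor [h] out of the energy rate before approximating: the quotient [D] has zero quadrature sum
    and is O(h^(2k))-close to a graded polynomial, whose quadrature error is also O(h^(2k)). The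
    factor then restores the missing order. *)
Lemma energy_error : bigO S S1 (k + k).+1 (fun h _ => E h 1 - E h 0).
Proof.
have Ug l : graded S 0 (U l).
  exact: (U_graded S01 K1 HP Hcb sk cK (L := L) (B := B) g_regular U_size U_deriv
    U_bounded).
have sg l : graded S 0 (slope l).
  exact: (slope_graded S01 K1 HP Hcb sk cK (L := L) (B := B) g_regular U_size
    U_deriv U_bounded).
pose D h x := \sum_l G (fun m => (U m h).[x]) l * (slope l h).[x].
have DE h x : S h -> \sum_l G (fun m => (U m h).[x]) l * (U l h)^`().[x] = h * D h x.
  move=> Sh; rewrite mulr_sumr; apply: eq_bigr => l _.
  by rewrite U_deriv // hornerZ mulrCA.
have [p gp hp] : approx S K (k + k) D.
  apply: approx_sum => // l _.
  apply: (approxM S01 (phi := fun h x => G (fun m => (U m h).[x]) l));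
    last exact: approx_graded.
  apply: approx_semilin => // [|m]; last exact: approx_graded.
  by apply: is_CnW g_regular.
have quad0 h : S h -> \sum_(i < k) b i * D h (c i) = 0.
  move=> Sh; have := quad_energy Sh; under eq_bigr do rewrite DE // mulrCA.
  rewrite -mulr_sumr => /eqP; rewrite mulf_eq0 => /orP[/eqP h0|/eqP //].
  by have := S01 Sh; rewrite h0 ltxx.
have intp : bigO S S1 (k + k) (fun h _ => integral01 (p h)).
  apply: (@bigO_eq _ _ _ _ _ (fun h _ => - (quad c b (p h) - integral01 (p h))
      - \sum_(i < k) b i * (D h (c i) - (p h).[c i]))).
    move=> h _ Sh _; under eq_bigr do rewrite mulrBr.
    by rewrite sumrB quad0 // /quad; ring.
  apply: bigOB.
    apply: bigON; apply: (graded_functional1 S01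
      (L := fun q : {poly R} => quad c b q - integral01 q)) => //.
      by move=> t u v; rewrite (quad_is_scalar c b) integral01D integral01Z; ring.
    by move=> i ik; rewrite (quad_exact HP Hcb) ?subrr // size_polyXn.
  apply: bigO_sum => i _; apply: bigOMl; first exact: bigO_cst.
  by apply: (bigO_comp (f := fun=> c i)) hp => _ _; exact: cK.
pose Z h x := E h x - E h 0 - h * (prim (p h)).[x].
have ZO : bigO S [set x : R | 0 <= x <= 1] (k + k).+1 Z.
  have Zder h (x : R) : S h -> is_derive x 1 (Z h) (h * (D h x - (p h).[x])).
    move=> Sh; have := E_deriv x Sh; rewrite DE // => dE.
    have := is_derive_horner (prim (p h)) x; rewrite deriv_prim => dp.
    have dZ := is_deriveB (is_deriveB dE (is_derive_cst (E h 0) x 1))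
      (is_deriveZ h dp).
    by apply: (is_derive_eq dZ); rewrite subr0 mulrBr.
  apply: (@bigO_mean_value _ _ _ _ (fun h x => h * (D h x - (p h).[x]))).
  - by move=> h _; rewrite /Z prim0E mulr0 subrr subr0.
  - move=> h Sh; apply: continuous_subspaceT => x.
    by apply/differentiable_continuous/derivable1_diffP; case: (Zder h x Sh).
  - by move=> h x Sh _; exact: Zder.
  - rewrite -add1n; apply: bigOM; first exact: bigO_step.
    apply: (bigO_comp (f := id)) hp => x /= /andP[x0 x1].
    by rewrite ger0_norm // (le_trans x1).
apply: (@bigO_eq _ _ _ _ _ (fun h _ => Z h 1 + h * integral01 (p h))).
  by move=> h _ _ _; rewrite /Z integral01E subrK.
apply: bigOD.
  by apply: (bigO_comp (f := fun=> 1)) ZO => _ _ /=; rewrite lexx ler01.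
by rewrite -add1n; apply: bigOM => //; exact: bigO_step.
Qed.

End Energy.

(** * The semi-discrete wave equation *)

Lemma semilin_mulmx (R : realType) d (A M M' : 'M[R]_d) g z l :
  semilin (A *m M) (A *m M') g z l = \sum_m A l m * semilin M M' g z m.
Proof.
rewrite /semilin; under [RHS]eq_bigr do rewrite mulr_sumr.
rewrite [RHS]exchange_big; apply: eq_bigr => i _; rewrite !mxE !mulr_suml -big_split.
by apply: eq_bigr => m _; rewrite mulrDr !mulrA.
Qed.

Section Wave.
Variables (R : realType) (N : nat).
Notation dx := (dx R N).
Notation T := (T_ R N).
Notation J := (J_ R N).

(** With [grad_pot], the matrices that put the gradient of the Hamiltonian in the form [semilin]
    with the derivative of [f] as nonlinearity. *)
Definition grad_lin : 'M[R]_(N + N) := dx *: block_mx (dx ^- 2 *: T) 0 0 1%:M.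

Definition grad_pot : 'M[R]_(N + N) := dx *: block_mx 1%:M 0 0 0.

Lemma T_sym i j : T i j = T j i.
Proof. by rewrite !mxE eq_sym orbC. Qed.

Lemma J_skew l m : J l m = - J m l.
Proof.
have /matrixP/(_ m l) : J^T = - J.
  by rewrite /J_ linearZ /= tr_block_mx !linear0 linearN /= !tr_scalar_mx
    -scalerN opp_block_mx !oppr0 opprK.
by rewrite !mxE.
Qed.

Lemma sum_delta_mx n (i : 'I_n) (z : 'I_n -> R) :
  \sum_j (1%:M : 'M[R]_n) i j * z j = z i.
Proof.
rewrite (bigD1 i) //= mxE eqxx mul1r big1 ?addr0 // => j ji.
by rewrite mxE eq_sym (negPf ji) mul0r.
Qed.

Lemma grad_l g z i : semilin grad_lin grad_pot g z (lshift N i) =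
  dx * (dx ^- 2 * \sum_j T i j * z (lshift N j) + g (z (lshift N i))).
Proof.
rewrite /semilin big_split_ord /= [X in _ + X]big1 ?addr0; last first.
  by move=> j _; rewrite [grad_lin _ _]mxE [grad_pot _ _]mxE !block_mxEur !mxE; ring.
rewrite big_split /= mulrDr; congr (_ + _).
  rewrite !mulr_sumr; apply: eq_bigr => j _.
  by rewrite [grad_lin _ _]mxE block_mxEul mxE; ring.
rewrite -(sum_delta_mx i (fun j => g (z (lshift N j)))) mulr_sumr;
  apply: eq_bigr => j _.
by rewrite [grad_pot _ _]mxE block_mxEul; ring.
Qed.

Lemma grad_r g z i : semilin grad_lin grad_pot g z (rshift N i) = dx * z (rshift N i).
Proof.
rewrite /semilin big_split_ord /= big1 ?add0r; last first.
  by move=> j _; rewrite [grad_lin _ _]mxE [grad_pot _ _]mxE !block_mxEdl !mxE; ring.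
rewrite -(sum_delta_mx i (fun j => z (rshift N j))) mulr_sumr; apply: eq_bigr => j _.
by rewrite [grad_lin _ _]mxE [grad_pot _ _]mxE !block_mxEdr !mxE; ring.
Qed.

Variable f : R -> R.

Lemma hamiltonianE (z : 'I_(N + N) -> R) : hamiltonian f (\col_l z l) =
  dx * ((\sum_i z (rshift N i) * z (rshift N i)) / 2
        + (\sum_i (\sum_j z (lshift N j) * T j i) * z (lshift N i)) / (2 * dx ^+ 2)
        + \sum_i f (z (lshift N i))).
Proof.
rewrite /hamiltonian; congr (_ * (_ / _ + _ / _ + _)).
- by rewrite mxE; apply: eq_bigr => i _; rewrite !mxE.
- rewrite mxE; apply: eq_bigr => i _; rewrite !mxE; congr (_ * _).
  by apply: eq_bigr => j _; rewrite !mxE.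
- by apply: eq_bigr => i _; rewrite !mxE.
Qed.

Hypothesis f1 : forall x : R, is_derive x 1 f (derive1 f x).

(** One chain rule for two uses: along coordinate lines it computes the gradient, along the step
    polynomial the energy rate. Symmetry of [T] merges the two halves of the derivative of the
    quadratic form. *)
Lemma hamiltonian_path (z dz : 'I_(N + N) -> R -> R) (x : R) :
  (forall l, is_derive x 1 (z l) (dz l x)) ->
  is_derive x 1 (fun x => hamiltonian f (\col_l z l x))
    (\sum_l semilin grad_lin grad_pot (derive1 f) (fun m => z m x) l * dz l x).
Proof.
move=> hz.
have -> : (fun x => hamiltonian f (\col_l z l x)) =
  dx *: (2^-1 *: (\sum_i z (rshift N i) * z (rshift N i))
   + (2 * dx ^+ 2)^-1 *: (\sum_i (\sum_j (T j i *: z (lshift N j))) * z (lshift N i))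
   + \sum_i (f \o z (lshift N i))).
  apply/funext => t; rewrite hamiltonianE !fctE !fct_sumE /=; congr (_ * (_ + _ + _)).
    by rewrite mulrC.
  rewrite mulrC; congr (_ * _); apply: eq_bigr => i _; rewrite fctE fct_sumE.
  by congr (_ * _); apply: eq_bigr => j _; rewrite mulrC.
have h1 := is_derive_sum (fun i => is_deriveM (hz (rshift N i)) (hz (rshift N i))).
have h2 := is_derive_sum (fun i => is_deriveM
  (is_derive_sum (fun j => is_deriveZ (T j i) (hz (lshift N j)))) (hz (lshift N i))).
have h3 := is_derive_sum (fun i => is_derive1_comp (f1 (z (lshift N i) x))
  (hz (lshift N i))).
have := is_deriveZ dx (is_deriveD (is_deriveD (is_deriveZ 2^-1 h1)
  (is_deriveZ (2 * dx ^+ 2)^-1 h2)) h3).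
move=> h; apply: (is_derive_eq h) => {h h1 h2 h3}.
pose p i := z (rshift N i) x; pose dp i := dz (rshift N i) x.
pose q i := z (lshift N i) x; pose dq i := dz (lshift N i) x.
transitivity (dx * (2^-1 * (\sum_i (p i * dp i + p i * dp i))
  + (2 * dx ^+ 2)^-1 *
    (\sum_i ((\sum_j T j i * q j) * dq i + q i * \sum_j T j i * dq j))
  + \sum_i derive1 f (q i) * dq i)).
  congr (_ * (_ + _ * _ + _)); apply: eq_bigr => i _; congr (_ * _ + _).
  by rewrite fct_sumE.
have e1 : \sum_i (p i * dp i + p i * dp i) = 2 * \sum_i p i * dp i.
  by rewrite mulr_sumr; apply: eq_bigr => i _; ring.
have e2 : \sum_i ((\sum_j T j i * q j) * dq i + q i * \sum_j T j i * dq j) =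
    2 * \sum_i (\sum_j T i j * q j) * dq i.
  rewrite big_split /= mulr_natl mulr2n; congr (_ + _).
    by apply: eq_bigr => i _; congr (_ * _); apply: eq_bigr => j _; rewrite T_sym.
  under eq_bigr do rewrite mulr_sumr; rewrite exchange_big; apply: eq_bigr => i _.
  by rewrite mulr_suml; apply: eq_bigr => j _; ring.
rewrite e1 e2 big_split_ord /= invfM.
under [X in _ = X + _]eq_bigr do rewrite grad_l -mulrA mulrDl -mulrA.
under [X in _ = _ + X]eq_bigr do rewrite grad_r -mulrA.
rewrite -!mulr_sumr big_split /= -mulr_sumr.
(* With the inverse square generalized, only the factor 2 has to be inverted and no condition on
   [dx] arises. *)
by move: (dx ^- 2) => a; field.
Qed.

Lemma gradient_hamiltonian y l : gradient (hamiltonian f) y l 0 =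
  semilin grad_lin grad_pot (derive1 f) (fun m => y m 0) l.
Proof.
rewrite mxE.
pose z m t := y m 0 + t * (m == l)%:R.
have zE h : h *: delta_mx l 0 + y = \col_m z m h.
  by apply/matrixP => i j; rewrite !mxE ord1 eqxx andbT /z addrC.
have z0 : y = \col_m z m 0 by rewrite -zE scale0r add0r.
pose Hz (t : R) := hamiltonian f (\col_m z m t).
(* Both derivatives are limits of the same difference quotient. *)
have -> : 'D_(delta_mx l 0) (hamiltonian f) y = 'D_(1 : R) Hz (0 : R).
  rewrite /derive (_ : (fun h => _) =
    (fun h : R => h^-1 *: ((Hz \o shift 0) (h *: 1) - Hz 0))) //.
  apply/funext => h /=; by rewrite /Hz zE -z0 [h *: 1]mulr1 addr0.
have hz m : is_derive (0 : R) 1 (z m : R -> R) (m == l)%:R.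
  have := is_deriveD (is_derive_cst (y m 0) (0:R) 1)
     (is_deriveM (is_derive_id (0:R) 1) (is_derive_cst ((m == l)%:R : R) (0 : R) 1)).
  move=> h; apply: (is_derive_eq h); rewrite add0r scaler0 add0r.
  by rewrite [_ *: _]mulr1.
have [_ ->] := hamiltonian_path (dz := fun m _ => (m == l)%:R) hz.
rewrite (bigD1 l) //= eqxx mulr1 big1 ?addr0 => [|m /negPf ->]; last by rewrite mulr0.
congr semilin; apply/funext => m; by rewrite /z mul0r addr0.
Qed.

Lemma wave_fieldE y l : wave_field f y l 0 =
  semilin (J *m grad_lin) (J *m grad_pot) (derive1 f) (fun m => y m 0) l.
Proof.
rewrite semilin_mulmx mxE; apply: eq_bigr => m _.
by rewrite gradient_hamiltonian.
Qed.

(** The quadratic terms have degree at most 2s, the potential at most [nu * s]; both are bounded by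
    2k. *)
Lemma hamiltonian_poly nu (z : 'I_(N + N) -> {poly R}) s k :
  (s <= k)%N -> (nu * s <= k + k)%N -> poly_fun nu f ->
    (forall l, (size (z l) <= s.+1)%N) ->
  exists2 q : {poly R}, (size q <= (k + k).+1)%N
    & forall x, hamiltonian f (\col_l (z l).[x]) = q.[x].
Proof.
move=> sk nusk [p sp fp] sz.
exists (dx *: (2^-1 *: (\sum_i z (rshift N i) * z (rshift N i))
   + (2 * dx ^+ 2)^-1 *: (\sum_i (\sum_j (T j i *: z (lshift N j))) * z (lshift N i))
   + \sum_i (p \Po z (lshift N i)))); last first.
  move=> x; rewrite hamiltonianE !hornerE !horner_sum; congr (_ * (_ + _ + _)).
  - by rewrite mulrC; congr (_ * _); apply: eq_bigr => i _; rewrite hornerM.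
  - rewrite mulrC; congr (_ * _); apply: eq_bigr => i _; rewrite hornerM horner_sum.
    by congr (_ * _); apply: eq_bigr => j _; rewrite hornerZ mulrC.
  - by apply: eq_bigr => i _; rewrite horner_comp fp.
have sum_le n (F : 'I_N -> {poly R}) : (forall i, (size (F i) <= n)%N) ->
  (size (\sum_i F i)%R <= n)%N.
  by move=> hF; apply: (leq_trans (size_sum _ _ _)); apply/bigmax_leqP => i _.
have mul_le (q r : {poly R}) : (size q <= s.+1)%N -> (size r <= s.+1)%N ->
  (size (q * r)%R <= (k + k).+1)%N.
  move=> hq hr; rewrite (leq_trans (size_polyMleq _ _)) //; lia.
rewrite (leq_trans (size_scale_leq _ _)) // (leq_trans (size_polyD _ _)) // geq_max.
apply/andP; split; last first.
  apply: (sum_le) => i; rewrite (leq_trans (size_comp_poly_leq _ _)) // ltnS.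
  by rewrite (leq_trans _ nusk) // leq_mul //;
    [move: sp | move: (sz (lshift N i))]; case: size.
rewrite (leq_trans (size_polyD _ _)) // geq_max; apply/andP; split.
  rewrite (leq_trans (size_scale_leq _ _)) //; apply: (sum_le) => i.
  by apply: (mul_le).
rewrite (leq_trans (size_scale_leq _ _)) //; apply: (sum_le) => i.
apply: (mul_le) => //; apply: (sum_le) => j.
exact: leq_trans (size_scale_leq _ _) (sz _).
Qed.

End Wave.

(** * Rescaling the step and passing to the limit *)

Section Scaled.
Variables (R : realType) (P : nat -> {poly R}) (k s d : nat) (c b : 'I_k -> R).
Variables (F : 'cV[R]_d -> 'cV[R]_d) (L B : 'I_d -> 'I_d -> R) (g : R -> R).
Hypothesis HP : orthonormal_legendre P.
Hypothesis FE : forall y l, F y l 0 = semilin L B g (fun m => y m 0) l.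

Definition scaled (u : R -> 'cV[{poly R}]_d) l h : {poly R} := u h l 0 \Po (h *: 'X).

Lemma scaled_horner u l h x : (scaled u l h).[x] = cvhorner (u h) (x * h) l 0.
Proof. by rewrite horner_comp hornerZ hornerX mxE mulrC. Qed.

Variables (y0 : 'cV[R]_d) (u : R -> 'cV[{poly R}]_d) (h : R).
Hypothesis uh : hbvm P s c b F y0 h (u h).

Lemma size_scaleX : (size (h *: 'X)%R <= 2)%N.
Proof. by rewrite (leq_trans (size_scale_leq _ _)) // size_polyX. Qed.

Lemma scaled_size l : (size (scaled u l h) <= s.+1)%N.
Proof.
have [su _ _] := uh; rewrite (leq_trans (size_comp_poly_leq _ _)) // ltnS.
rewrite -[s]muln1 leq_mul //; first by move: (su l); case: size.
by move: size_scaleX; case: size.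
Qed.

(** The method's equation is given on [0, 1] only; [coef_bound] with bound 0 shows that the
    difference of the two sides vanishes as a polynomial. *)
Lemma scaled_deriv l : (scaled u l h)^`() = h *: slope P s c b L B g (scaled u) l h.
Proof.
have [su _ eu] := uh.
rewrite deriv_comp derivZ derivX alg_polyC mulrC mul_polyC; congr (_ *: _).
set p := _ \Po _; set q := slope _ _ _ _ _ _ _ _ _ _; pose r := p - q.
suff r0 : r = 0 by apply/eqP; rewrite -subr_eq0 -/r r0.
have [C _ hC] := coef_bound HP (size r).
apply/polyP => i; apply/eqP; rewrite coef0 -normr_le0.
rewrite (le_trans (hC r 0 (leqnn _) _ i)) ?mulr0 // => x hx.
rewrite normr_le0 hornerD hornerN subr_eq0; apply/eqP.
have := congr1 (fun v : 'cV[R]_d => v l 0) (eu x hx); rewrite summxE mxE mxE => E.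
rewrite horner_comp hornerZ hornerX mulrC E horner_sum; apply: eq_bigr => j _.
rewrite hornerZ mxE mulrC; congr (_ * _); rewrite summxE; apply: eq_bigr => i' _.
rewrite mxE FE; congr (_ * semilin _ _ _ _ _); apply/funext => m.
by rewrite scaled_horner.
Qed.

End Scaled.

(** * One-sided limits, norms by coordinates and Landau symbols *)

Section Limits.
Variable R : realType.

Lemma near_right0P (Q : R -> Prop) :
  (\forall t \near 0^'+, Q t) <-> exists2 e, 0 < e & forall t, 0 < t < e -> Q t.
Proof.
split=> [|[e e0 he]].
  rewrite near_withinE => /nbhs_ballP[e /= e0 he]; exists e => // t /andP[t0 te].
  by apply: he => //=; rewrite /ball /= sub0r normrN gtr0_norm.
near=> t; apply: he; apply/andP; split; near: t;
  [exact: nbhs_right_gt|exact: nbhs_right_lt].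
Unshelve. all: by end_near. Qed.

Lemma coord_le_norm d (v : 'cV[R]_d) l : `|v l 0| <= `|v|.
Proof. by rewrite [leRHS]/Num.Def.normr /= mx_normrE; apply/bigmax_geP; right;
  exists (l, 0). Qed.

Lemma norm_le_coord d (v : 'cV[R]_d) M : 0 <= M -> (forall l, `|v l 0| <= M) ->
  `|v| <= M.
Proof.
move=> M0 hv; rewrite /Num.Def.normr /= mx_normrE; apply: bigmax_le => // -[i j] _ /=.
by rewrite ord1.
Qed.

Lemma bigO_landau (a : R -> R) h1 n : 0 < h1 ->
  bigO [set h | 0 < h < h1] [set: unit] n (fun h _ => a h) ->
  a =O_ (0^'+) (fun h : R => h ^+ n).
Proof.
move=> h10 [C C0 hC]; apply/eqO_exP; exists (C + 1); first by rewrite ltr_wpDl.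
apply/near_right0P; exists h1 => // h hh.
apply: (le_trans (hC h tt hh I)).
have h0 : 0 <= h ^+ n by case/andP: hh => /ltW /exprn_ge0.
by rewrite (ger0_norm h0) ler_wpM2r // lerDl.
Qed.

Lemma bigO_landau_col d (a : R -> 'cV[R]_d) h1 n : 0 < h1 ->
  (forall l, bigO [set h | 0 < h < h1] [set: unit] n (fun h _ => a h l 0)) ->
  a =O_ (0^'+) (fun h : R => h ^+ n).
Proof.
move=> h10 ha.
have /choice[C hC] : forall l, exists C, 0 <= C /\
    forall h, 0 < h < h1 -> `|a h l 0| <= C * h ^+ n.
  by move=> l; have [C C0 hC] := ha l; exists C; split=> // h hh; exact: (hC h tt).
pose D := \sum_l C l.
have D0 : 0 <= D by apply: sumr_ge0 => l _; case: (hC l).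
apply/eqO_exP; exists (D + 1); first by rewrite ltr_wpDl.
apply/near_right0P; exists h1 => // h hh.
have h0 : 0 <= h ^+ n by case/andP: hh => /ltW /exprn_ge0.
apply: norm_le_coord => [|l]; first by rewrite mulr_ge0 // addr_ge0.
apply: (le_trans ((hC l).2 h hh)); rewrite (ger0_norm h0) ler_wpM2r //.
rewrite /D (bigD1 l) //= -addrA lerDl addr_ge0 // sumr_ge0 // => m _.
by case: (hC m).
Qed.

Lemma is_derive_coord d (y : R -> 'cV[R]_d) (t : R) v l :
  is_derive t 1 y v -> is_derive t 1 (fun t => y t l 0) (v l 0).
Proof.
move=> [dy <-]; apply: DeriveDef; first exact: (derivable_mxP y t 1).1 dy l 0.
by rewrite derive_mx // mxE.
Qed.

Lemma ode_right_continuous d (F : 'cV[R]_d -> 'cV[R]_d) y0 T (y : R -> 'cV[R]_d) :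
  0 < T -> ode_solution F y0 T y -> y t @[t --> 0^'+] --> y 0.
Proof.
move=> T0 [_ cy _]; have T2 : 0 < T / 2 by rewrite divr_gt0.
(* On a closed subinterval, continuity can be split into interior continuity and one-sided
   limits. *)
have : {within `[0, T / 2], continuous y}.
  apply: continuous_subspaceW cy => t /=; rewrite !in_itv /= => /andP[-> tT].
  by lra.
by move=> /(continuous_within_itvP _ T2)[].
Qed.

(** As h < T, the endpoint x = 1 is still interior for [z]; only x = 0 needs the one-sided limit. *)
Lemma scaled_within (z dz : R -> R) (h T : R) : 0 < h < T ->
  z t @[t --> 0^'+] --> z 0 -> (forall t : R, 0 < t < T -> is_derive t 1 z (dz t)) ->
  {within `[0, 1], continuous (fun x : R => z (x * h))} /\
  forall x : R, 0 < x < 1 -> is_derive x 1 (fun x => z (x * h)) (h * dz (x * h)).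
Proof.
move=> /andP[h0 hT] z0 hz.
have der (x : R) : 0 < x <= 1 -> is_derive x 1 (fun x => z (x * h)) (h * dz (x * h)).
  move=> /andP[x0 x1]; have xhT : 0 < x * h < T.
    by rewrite mulr_gt0 //= (le_lt_trans _ hT) // ler_piMl // ltW.
  have dm : is_derive x 1 (fun x : R => x * h) h.
    have := is_deriveM (is_derive_id x (1 : R)) (is_derive_cst h x 1).
    move=> dm; apply: (is_derive_eq dm).
    by rewrite scaler0 add0r [_ *: _]mulr1.
  by rewrite mulrC; exact: (is_derive1_comp (g := fun x : R => x * h) (hz _ xhT) dm).
have cont (x : R) : 0 < x <= 1 -> {for x, continuous (fun x : R => z (x * h))}.
  by move=> hx; apply/differentiable_continuous/derivable1_diffP; case: (der x hx).
split=> [|x /andP[x0 x1]]; last by apply: der; rewrite x0 ltW.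
apply/(continuous_within_itvP _ ltr01); split.
- by move=> x; rewrite in_itv /= => /andP[x0 x1]; apply: cont; rewrite x0 ltW.
- rewrite mul0r; apply/cvgrPdist_lt => e e0.
  have [r r0 hr] := (near_right0P _).1 ((cvgrPdist_lt _ _).1 z0 e e0).
  apply/near_right0P; exists (r / h) => [|t /andP[t0 tr]]; first exact: divr_gt0.
  by apply: hr; rewrite mulr_gt0 //= -ltr_pdivlMr.
- by apply: cvg_at_left_filter; apply: cont; rewrite ltr01 lexx.
Qed.

End Limits.

Unset Implicit Arguments.

Theorem theorem2 (R : realType) (k s : nat) (hs : (1 <= s)%N) (hsk : (s <= k)%N) :
  exists m : nat,
  forall (P : nat -> {poly R}) (c b : 'I_k -> R)
    (N : nat) (f psi0 psi1 : R -> R)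
    (T h0 : R) (y : R -> 'cV[R]_(N + N)) (u : R -> 'cV[{poly R}]_(N + N)),
  orthonormal_legendre P ->
  gauss_legendre P c b ->
  (0 < N)%N ->
  is_Cn m f ->
  let H := hamiltonian f in
  let y0 := wave_init N psi0 psi1 in
  let y1 := fun h : R => cvhorner (u h) h in
  0 < T -> ode_solution (wave_field f) y0 T y ->
  0 < h0 -> hbvm_family P s c b (wave_field f) y0 h0 u ->
  ((fun h : R => y1 h - y h) =O_ (0^'+) (fun h : R => h ^+ (2 * s).+1)) /\
  ((exists2 nu : nat, poly_fun nu f & nu%:R <= (2 * k)%:R / s%:R :> R) ->
     forall h, 0 < h < h0 -> H (y1 h) - H y0 = 0) /\
  (~ (exists2 nu : nat, poly_fun nu f & nu%:R <= (2 * k)%:R / s%:R :> R) ->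
     (fun h : R => H (y1 h) - H y0) =O_ (0^'+) (fun h : R => h ^+ (2 * k).+1)).
Proof.
(* One derivative is spent in passing to [derive1 f], which is then of class 2k + 1 as [g_regular]
   asks. *)
exists (k + k).+2 => P c b N f psi0 psi1 T h0 y u HP Hcb N0 hf H y0 y1 T0 hy h00
  [hu [M hM]].
have [yini _ yder] := hy.
have f1 (x : R) : is_derive x 1 f (derive1 f x) := is_Cn_is_derive x hf.
have greg : is_Cn (k + k).+1 (derive1 f) := is_Cn_derive hf.
have FE := @wave_fieldE R N f f1.
set L := J_ R N *m grad_lin R N in FE; set B := J_ R N *m grad_pot R N in FE.
have UE h l x := scaled_horner u l h x.
set U := scaled u in UE.
(* Exact conservation is claimed on this whole range, so its ingredients are stated here; the
   asymptotic claims use the smaller set [S] below. *)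
pose S0 := [set h : R | 0 < h < h0].
have Usize l h : S0 h -> (size (U l h) <= s.+1)%N by move=> /hu /scaled_size.
have Uder l h : S0 h -> (U l h)^`() = h *: slope P s c b L B (derive1 f) U l h.
  by move=> /hu uh; exact: (scaled_deriv HP FE uh).
have U1 h : y1 h = \col_l (U l h).[1].
  by apply/colP => l; rewrite [RHS]mxE UE mul1r.
have U0 h : S0 h -> y0 = \col_l (U l h).[0].
  move=> /hu[_ <- _]; apply/colP => l; by rewrite [RHS]mxE UE mul0r.
pose E h x := H (\col_l (U l h).[x]).
have Eder h (x : R) : is_derive x 1 (E h)
    (\sum_l semilin (grad_lin R N) (grad_pot R N) (derive1 f) (fun m => (U m h).[x]) l
      * (U l h)^`().[x]).
  apply: (hamiltonian_path f1 (z := fun l x => (U l h).[x])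
    (dz := fun l x => (U l h)^`().[x])) => l; exact: is_derive_horner.
have EH h : S0 h -> H (y1 h) - H y0 = E h 1 - E h 0.
  by move=> Sh; rewrite /E -U1 -U0.
have Fham z l := semilin_mulmx (J_ R N) (grad_lin R N) (grad_pot R N) (derive1 f) z l.
have Jsk := @J_skew R N.
have y_right := ode_right_continuous T0 hy.
(* Below [e] the step polynomials are bounded by [M] and the solution stays within distance 1 of its
   initial value. *)
have [e e0 he] := (near_right0P _).1
  (filterI hM ((cvgrPdist_lt _ _).1 y_right 1 ltr01)).
pose h1 := Num.min (Num.min e h0) (Num.min T 1).
have h10 : 0 < h1 by rewrite !lt_min e0 h00 T0 ltr01.
pose S := [set h : R | 0 < h < h1].
have SP h : S h -> [/\ 0 < h, h < e, h < h0, h < T & h < 1].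
  by rewrite /S /= !lt_min => /andP[? /andP[/andP[? ?] /andP[? ?]]].
have S01 h : S h -> 0 < h <= 1 by move=> /SP[-> _ _ _ /ltW].
have SS0 h : S h -> S0 h by move=> /SP[h_gt0 _ hh _ _]; rewrite /S0 /= h_gt0.
(* Chosen so that [-K, K] contains both [0, 1] and all nodes. *)
pose K := 1 + \sum_i `|c i|.
have K1 : 1 <= K by rewrite lerDl sumr_ge0.
have cK i : `|c i| <= K.
  by rewrite /K (bigD1 i) //= addrCA lerDl addr_ge0 ?sumr_ge0.
have Ubd : exists M, forall l h x, S h -> 0 <= x <= 1 -> `|(U l h).[x]| <= M.
  exists M => l h x /SP[h_gt0 h_lt _ _ _] hx;
    rewrite UE (le_trans (coord_le_norm _ _)) //.
  have [] := he h; first by rewrite h_gt0.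
  by move=> /(_ x hx).
pose Y l h x := y (x * h) l 0.
have Ysc l h : S h -> {within `[0, 1], continuous (Y l h)} /\
    forall x : R, 0 < x < 1 ->
      is_derive x 1 (Y l h) (h * wave_field f (y (x * h)) l 0).
  move=> /SP[h_gt0 _ _ hT _].
  apply: (scaled_within (z := fun t => y t l 0)
    (dz := fun t => wave_field f (y t) l 0) (T := T)).
  - by rewrite h_gt0.
  - apply: (@cvg_comp _ _ _ y (fun v : 'cV[R]_(N + N) => v l 0) _ _ _ y_right).
    exact: coord_continuous.
  - by move=> t /yder; exact: is_derive_coord.
have step_err l : bigO S [set: unit] (s + s).+1 (fun h _ => (U l h).[1] - Y l h 1).
  apply: (step_error S01 K1 HP Hcb hs hsk cK (L := L) (B := B) greg (U := U)
    (fun l h Sh => Usize l h (SS0 h Sh)) (fun l h Sh => Uder l h (SS0 h Sh))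
    Ubd (Y := Y)).
  - by move=> m h /SS0 /U0 /colP/(_ m); rewrite [RHS]mxE /Y mul0r yini.
  - by move=> m h /(Ysc m)[].
  - by move=> m h x /(Ysc m)[_ h2] /h2; rewrite FE.
  - move=> m; exists (`|y 0| + 1) => [|h x]; first exact: addr_ge0.
    move=> /SP[h_gt0 h_lt _ _ _] /= /andP[x0 x1]; rewrite expr0 mulr1 /Y.
    rewrite (le_trans (coord_le_norm _ _)) //.
    (* The bound obtained from the right limit concerns positive times only, so the initial time is
       separate. *)
    have [->|xn0] := eqVneq x 0; first by rewrite mul0r lerDl.
    have x_gt0 : 0 < x by rewrite lt_neqAle eq_sym xn0.
    have [|_ hh] := he (x * h).
      rewrite mulr_gt0 //= (le_lt_trans _ h_lt) //.
      by rewrite ler_piMl // ltW.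
    rewrite -lerBlDl (le_trans (lerB_dist _ _)) // distrC ltW //.
split; [|split].
- rewrite mul2n -addnn; apply: bigO_landau_col h10 _ => l.
  apply: bigO_eq (step_err l) => h _ _ _.
  by rewrite U1 !mxE /Y mul1r.
- move=> [nu fnu nuk] h hh; rewrite EH //.
  have nusk : (nu * s <= k + k)%N.
    by rewrite addnn -mul2n -(ler_nat R) natrM -ler_pdivlMr // ltr0n.
  have [q sq Eq] := hamiltonian_poly hsk nusk fnu (fun l => Usize l h hh).
  exact: (energy_exact HP Hcb Jsk Fham Uder (fun h x _ => Eder h x) hh sq Eq).
- move=> _; rewrite mul2n -addnn; apply: bigO_landau h10 _.
  apply: (@bigO_eq _ _ _ _ _ (fun h _ => E h 1 - E h 0)).
    by move=> h _ /SS0 Sh _; rewrite EH.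
  exact: (energy_error HP Hcb Jsk Fham (fun l h Sh => Uder l h (SS0 h Sh))
    (fun h x _ => Eder h x) S01 K1 hsk cK greg
    (fun l h Sh => Usize l h (SS0 h Sh)) Ubd).
Qed.
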